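(* Let $A,B\in\mathcal A$ be positive and invertible ($A,B>0$), and assume that there is $z_0\in\mathbb C$ with $\frac14\le\mathrm{Re}(z_0)\le\frac34$ such that $$\tau(A^{z_0}B^{z_0}A^{1-z_0}B^{1-z_0})=\tau(AB).$$ Then $A$ commutes with $B$, and $\tau(A^{z}B^{z}A^{1-z}B^{1-z})=\tau(AB)$ for every $z\in\mathbb C$.
   Context: $\mathcal A$ denotes an operator algebra with trace $Tr$: either $\mathcal A=M_n(\mathbb C)$ with its usual trace, or $\mathcal A=B_2(H)$, the Hilbert–Schmidt operators on a separable complex Hilbert space $H$ with the usual (infinite) trace, or $(\mathcal A,Tr)$ a $C^*$-algebra with a finite faithful (positive, tracial) trace. Write $\tau(X)=\mathrm{Re}\,Tr(X)$. $A>0$ means that $A$ is positive and invertible. For $A>0$ and $z\in\mathbb C$, $A^z=\exp(z\log A)$ is defined by functional calculus. *)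

(* Defs.v *)
From HB Require Import structures.
From mathcomp Require Import all_boot all_order all_algebra.
From mathcomp Require Import spectral complex.
From mathcomp Require Import all_classical all_reals all_analysis.
Set Implicit Arguments.
Unset Strict Implicit.
Unset Printing Implicit Defensive.
Import Order.TTheory GRing.Theory Num.Theory.
Import numFieldNormedType.Exports.
Local Open Scope classical_set_scope.
Local Open Scope ring_scope.
Local Open Scope sesquilinear_scope.

Definition cexp (R : realType) (w : R[i]) : R[i] :=
  ((expR (complex.Re w))%:C * (cos (complex.Im w) +i* sin (complex.Im w)))%C.

(* The function t |-> t^z = exp(z log t) on ]0, +oo[.  Its argument is complex
   because spectra are sets of complex numbers; it is only used at real t > 0. *)
Definition powfun (R : realType) (z t : R[i]) : R[i] :=
  cexp (z * (ln (complex.Re t))%:C%C).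

(* Unital C*-algebras.  The norm is a field of the structure because the library
   has no common substructure of rings and normed modules below numDomainType,
   so that HB rejects the join of completeNormedModType and algType.  As in
   normedModType R[i], norms are nonnegative reals seen in R[i]. *)

HB.mixin Record isCStarAlgebra (R : realType) A of GRing.Algebra R[i] A := {
  cstar_norm : A -> R[i];
  cstar_ler_normD : forall x y,
    cstar_norm (x + y) <= cstar_norm x + cstar_norm y;
  cstar_normZ : forall (a : R[i]) x, cstar_norm (a *: x) = `|a| * cstar_norm x;
  cstar_norm0_eq0 : forall x, cstar_norm x = 0 -> x = 0;
  cstar_complete : forall u : nat -> A,
    (forall e : R[i], 0 < e -> exists N, forall m n,
      (N <= m)%N -> (N <= n)%N -> cstar_norm (u m - u n) < e) ->
    exists l, forall e : R[i], 0 < e -> exists N, forall n,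
      (N <= n)%N -> cstar_norm (u n - l) < e;
  star : A -> A;
  starK : forall x, star (star x) = x;
  star_antilinear : forall (a : R[i]) x y,
    star (a *: x + y) = a^* *: star x + star y;
  starM : forall x y, star (x * y) = star y * star x;
  cstar_normM : forall x y, cstar_norm (x * y) <= cstar_norm x * cstar_norm y;
  cstar_identity : forall x, cstar_norm (star x * x) = cstar_norm x ^+ 2
}.

#[short(type="cstarType")]
HB.structure Definition CStarAlgebra (R : realType) :=
  {A of isCStarAlgebra R A & GRing.Algebra R[i] A}.

Section CStar.
Context (R : realType) (A : cstarType R).
Implicit Types (a b : A) (z : R[i]).

Definition cstar_invertible a := exists b, a * b = 1 /\ b * a = 1.

Definition cstar_spectrum a : set R[i] :=
  [set l | ~ cstar_invertible (a - l%:A)].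

Definition cstar_positive a :=
  star a = a /\ forall l, cstar_spectrum a l -> 0 <= l.

(* Continuous functional calculus of a self-adjoint element: b = f(a) is the
   norm limit of p(a) for polynomials p converging to f uniformly on the
   spectrum of a. *)
Definition cstar_fcalc (f : R[i] -> R[i]) a b :=
  forall e : R[i], 0 < e -> exists p : {poly R[i]},
    (forall l, cstar_spectrum a l -> `|p.[l] - f l| < e) /\
    cstar_norm (horner_alg a p - b) < e.

Definition cstar_pow a z : A := xget 1 (cstar_fcalc (powfun z) a).

(* Finiteness of the trace is built in: it is everywhere defined. *)
Definition finite_faithful_trace (Tr : A -> R[i]) :=
  [/\ forall (c : R[i]) a b, Tr (c *: a + b) = c * Tr a + Tr b,
      forall a, 0 <= Tr (star a * a),
      forall a b, Tr (a * b) = Tr (b * a)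
    & forall a, Tr (star a * a) = 0 -> a = 0].

End CStar.

(* Complex Hilbert spaces; the inner product is linear on the left. *)

HB.mixin Record isHilbert (R : realType) H of CompleteNormedModule R[i] H := {
  ip : H -> H -> R[i];
  ip_linear : forall (a : R[i]) x y w, ip (a *: x + y) w = a * ip x w + ip y w;
  ip_conj : forall x y, ip y x = (ip x y)^*;
  ip_norm : forall x : H, ip x x = `|x| ^+ 2
}.

#[short(type="hilbertType")]
HB.structure Definition Hilbert (R : realType) :=
  {H of isHilbert R H & CompleteNormedModule R[i] H}.

Section HilbertSchmidt.
Context (R : realType) (H : hilbertType R).
Implicit Types (T S : H -> H) (z : R[i]).

Definition separable := exists D : set H, countable D /\ dense D.

Definition bounded_operator T := linear T /\ continuous T.

Definition op_invertible T :=
  exists S, [/\ bounded_operator S, T \o S = id & S \o T = id].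

Definition op_spectrum T : set R[i] :=
  [set l | ~ op_invertible (fun x => T x - l *: x)].

Definition op_positive T := forall x, 0 <= ip (T x) x.

Definition op_horner (p : {poly R[i]}) T : H -> H :=
  fun x => \sum_(i < size p) p`_i *: iter i T x.

(* Continuous functional calculus, as for C*-algebras; the last condition says
   that the operator norm of p(T) - S is at most e. *)
Definition op_fcalc (f : R[i] -> R[i]) T S :=
  bounded_operator S /\
  forall e : R[i], 0 < e -> exists p : {poly R[i]},
    (forall l, op_spectrum T l -> `|p.[l] - f l| < e) /\
    (forall x, `|op_horner p T x - S x| <= e * `|x|).

Definition op_pow T z : H -> H := xget (id : H -> H) (op_fcalc (powfun z) T).

(* The basis is (e i) for i in I, so that I finite and I infinite cover the
   finite- and infinite-dimensional separable spaces. *)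
Definition orthonormal_basis (I : set nat) (e : nat -> H) :=
  (forall i j, I i -> I j -> ip (e i) (e j) = (i == j)%:R) /\
  (forall x, (forall i, I i -> ip x (e i) = 0) -> x = 0).

Definition hilbert_schmidt (I : set nat) (e : nat -> H) : set (H -> H) :=
  [set T | bounded_operator T /\
    exists M : R[i], forall n, \sum_(i < n | `[< I i >]) `|T (e i)| ^+ 2 <= M].

Definition op_trace (I : set nat) (e : nat -> H) T : R[i] :=
  limn (fun n => \sum_(i < n | `[< I i >]) ip (T (e i)) (e i) : R[i]^o).

End HilbertSchmidt.

Section Matrices.
Context (R : realType) (n : nat).
Implicit Types (A : 'M[R[i]]_n) (z : R[i]).

Definition mx_positive A :=
  A^t* = A /\ forall v : 'rV[R[i]]_n, 0 <= (v *m A *m v^t*) 0 0.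

(* The spectral theorem gives A = invmx U *m diag_mx d *m U with U unitary. *)
Definition mx_pow A z : 'M[R[i]]_n :=
  invmx (spectralmx A) *m diag_mx (map_mx (powfun z) (spectral_diag A))
    *m spectralmx A.

End Matrices.

(* The set alg_mem is the algebra itself; ambient is the unital algebra in which the
   powers of its elements are computed.  The two differ only for the
   Hilbert-Schmidt operators, whose powers live among the bounded operators.
   Invertibility is also taken there: a Hilbert-Schmidt operator has a bounded
   inverse only in finite dimension. *)
Record tracedAlgebra (R : realType) := TracedAlgebra {
  ambient :> Type;
  alg_mem : set ambient;
  mul : ambient -> ambient -> ambient;
  positive : ambient -> Prop;
  invertible : ambient -> Prop;
  pow : ambient -> R[i] -> ambient;
  Tr : ambient -> R[i]
}.

Definition matrix_algebra (R : realType) (n : nat) : tracedAlgebra R :=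
  {| ambient := 'M[R[i]]_n;
     alg_mem := setT;
     mul := fun A B => A *m B;
     positive := @mx_positive R n;
     invertible := fun A => A \in unitmx;
     pow := @mx_pow R n;
     Tr := fun A => \tr A |}.

Definition hilbert_schmidt_algebra (R : realType) (H : hilbertType R)
    (I : set nat) (e : nat -> H) : tracedAlgebra R :=
  {| ambient := H -> H;
     alg_mem := hilbert_schmidt I e;
     mul := fun S T => S \o T;
     positive := @op_positive R H;
     invertible := @op_invertible R H;
     pow := @op_pow R H;
     Tr := op_trace I e |}.

Definition cstar_algebra (R : realType) (A : cstarType R) (Tr : A -> R[i]) :
    tracedAlgebra R :=
  {| ambient := A;
     alg_mem := setT;
     mul := fun a b => a * b;
     positive := @cstar_positive R A;
     invertible := @cstar_invertible R A;
     pow := @cstar_pow R A;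
     Tr := Tr |}.

Variant operator_algebra (R : realType) : tracedAlgebra R -> Prop :=
| MatrixAlgebra n : operator_algebra (matrix_algebra R n)
| HilbertSchmidtAlgebra (H : hilbertType R) (I : set nat) (e : nat -> H) :
    separable H -> orthonormal_basis I e ->
    operator_algebra (hilbert_schmidt_algebra I e)
| TracialCStarAlgebra (A : cstarType R) (Tr : A -> R[i]) :
    finite_faithful_trace Tr -> operator_algebra (cstar_algebra Tr).

Definition tau (R : realType) (X : tracedAlgebra R) (x : X) : R :=
  complex.Re (Tr x).

Notation "x ⋅ y" := (mul x y) (at level 40, left associativity).
Notation "x ^z z" := (pow x z) (at level 30, z at level 29).

(* Main.v *)
Require Import Defs.
From mathcomp Require Import all_boot all_order all_algebra.
From mathcomp Require Import spectral complex.
From mathcomp Require Import all_classical all_reals all_analysis.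
From mathcomp Require Import ring lra.

(** Let [F(z) = Tr (A^z B^z A^(1-z) B^(1-z))], [u = Re F], [c = tau(A B)] and
    [m = u(1/2)], the value [tau ((A^(1/2) B^(1/2))^2)].  With
    [X = A^(1/2) B^(1/2)] and [D = X - X^*], one finds [tau (D^* D) = 2 (c - m)]; so
    [m <= c], and [m = c] only if [A^(1/2)] and [B^(1/2)] commute ([heinz_mid_eq]).
    It remains to show that [u <= (m + c) / 2] on the strip [1/4 <= Re z <= 3/4], for
    then the hypothesis gives [c <= (m + c) / 2], hence [m = c].  Once [A] and [B]
    commute, all their powers commute and [F] is constant.

    On the line [Re z = 1/4], [F(z) = Tr (P Q)] with [P = B^(1/4) A^z B^z A^(1/4)] and
    [Q = A^w B^w], [w = 3/4 - z] having real part [1/2].  Then [Tr (Q^* Q) = c], and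
    [Tr (P P^* )] is the trace of the product of [A^(z^* ) B^(1/2) A^z] and
    [B^z A^(1/2) B^(z^* )], two self-adjoint elements whose squares have
    trace [m].  Two uses of Cauchy-Schwarz give [u <= (m + c) / 2] ([heinz_quarter]).
    The line [Re z = 3/4] follows from [F(1 - z) = F(z)].

    Between the two lines the bound is a maximum principle for the bounded harmonic
    function [u].  It is proved with discrete Laplacians ([strip_maximum_principle]):
    the product of the four powers has an expansion of order two whose remainder is
    bounded uniformly on the strip, because imaginary powers are bounded.

    This argument runs in any algebra with a trace and with complex powers
    ([heinz_equality]), and the rest constructs these powers.  For matrices they come
    from the spectral theorem.  A Hilbert-Schmidt operator with a bounded inverse lives
    on a finite-dimensional space ([hilbert_schmidt_finite]), where coordinates lead
    back to matrices.  For C*-algebras one needs the functional calculus, and so the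
    fact that the norm of [p(a)], for [a] self-adjoint with real spectrum, is at most
    the supremum of [|p|] on the spectrum ([nrm_horner_le]); it follows from the
    existence of a point of the spectrum of modulus equal to the norm
    ([selfadjoint_circle_spectrum]).  The functions [t^z] and [ln] are limits of
    polynomials on the spectrum by Bernstein's theorem. *)

Set Implicit Arguments.
Unset Strict Implicit.
Unset Printing Implicit Defensive.
Import Order.TTheory GRing.Theory Num.Theory.
Import numFieldNormedType.Exports.
Local Open Scope classical_set_scope.
Local Open Scope ring_scope.

(** * The modulus of a complex number as a real number *)

Section Modulus.
Context (R : realType).
Implicit Types (z w : R[i]) (x y : R).

Definition cabs z : R := complex.Re `|z|.

Lemma cabsE z : `|z| = (cabs z)%:C%C.
Proof. by rewrite /cabs normc_def. Qed.

Lemma cabs_ge0 z : 0 <= cabs z.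
Proof. by rewrite -ler0c -cabsE. Qed.

Lemma cabsM z w : cabs (z * w) = cabs z * cabs w.
Proof. by apply: complexI; rewrite rmorphM /= -!cabsE normrM. Qed.

Lemma cabsD z w : cabs (z + w) <= cabs z + cabs w.
Proof. by rewrite -lecR rmorphD /= -!cabsE ler_normD. Qed.

Lemma cabsN z : cabs (- z) = cabs z.
Proof. by rewrite /cabs normrN. Qed.

Lemma cabsB z w : cabs (z - w) <= cabs z + cabs w.
Proof. by rewrite -(cabsN w) cabsD. Qed.

Lemma cabs_distC z w : cabs (z - w) = cabs (w - z).
Proof. by rewrite /cabs distrC. Qed.

Lemma cabs0 : cabs 0 = 0. Proof. by rewrite /cabs normr0. Qed.

Lemma cabs1 : cabs 1 = 1. Proof. by rewrite /cabs normr1. Qed.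

Lemma cabs0_eq0 z : cabs z = 0 -> z = 0.
Proof. by move=> h; apply/eqP; rewrite -normr_eq0 cabsE h. Qed.

Lemma cabs_gt0 z : (0 < cabs z) = (z != 0).
Proof. by rewrite -ltcR -cabsE normr_gt0. Qed.

Lemma cabsX z n : cabs (z ^+ n) = cabs z ^+ n.
Proof. by elim: n => [|n ih]; rewrite ?expr0 ?cabs1 // !exprS cabsM ih. Qed.

Lemma cabsV z : cabs z^-1 = (cabs z)^-1.
Proof. by apply: complexI; rewrite fmorphV /= -!cabsE normfV. Qed.

Lemma cabs_real x : cabs x%:C%C = `|x|.
Proof. by rewrite /cabs normc_def /= expr0n addr0 sqrtr_sqr. Qed.

Lemma cabs_conj z : cabs z^* = cabs z.
Proof. by rewrite /cabs norm_conjC. Qed.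

Lemma cabs_Re z : `|complex.Re z| <= cabs z.
Proof. by rewrite -lecR -cabsE normc_ge_Re. Qed.

Lemma conjC_realE x : (x%:C%C)^* = x%:C%C :> R[i].
Proof. by apply/eqP; rewrite eq_complex /= oppr0 !eqxx. Qed.

Lemma cabs_i : cabs 'i%C = 1.
Proof. by rewrite /cabs normc_def /= expr0n add0r expr1n sqrtr1. Qed.

Lemma cabs_le z : cabs z <= `|complex.Re z| + `|complex.Im z|.
Proof.
rewrite {1}[z]complexE; apply: le_trans (cabsD _ _) _.
by rewrite cabsM cabs_i mul1r !cabs_real.
Qed.

Lemma cabs_sum (I : Type) (r : seq I) (P : pred I) (F : I -> R[i]) :
  cabs (\sum_(i <- r | P i) F i) <= \sum_(i <- r | P i) cabs (F i).
Proof.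
elim/big_ind2: _ => [|x1 x2 y1 y2 h1 h2|//]; first by rewrite cabs0.
exact: le_trans (cabsD _ _) (lerD h1 h2).
Qed.

Lemma cabs_lt z x : (`|z| < x%:C%C) = (cabs z < x).
Proof. by rewrite cabsE ltcR. Qed.

Lemma gt0_complex z : 0 < z -> exists2 x : R, 0 < x & z = x%:C%C.
Proof.
case: z => x y; rewrite ltcE /= => /andP[/eqP-> h].
by exists x.
Qed.

Lemma ge0_complex z : 0 <= z -> exists2 x : R, 0 <= x & z = x%:C%C.
Proof.
case: z => x y; rewrite lecE /= => /andP[/eqP-> h].
by exists x.
Qed.

End Modulus.

(** * A maximum principle on strips *)

(** At an interior point where [u + eps x^2] is within [eta] of its supremum, the
    four neighbours at distance [h] exceed it by at most [eta], so its discrete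
    Laplacian is at most [4 eta]; but this Laplacian is at least
    [2 eps h^2 - K h^3], which is positive for small [h].  So the supremum is
    approached only near the boundary.  Asking for constants that are uniform
    over the strip makes the argument independent of compactness. *)
Lemma strip_maximum_principle (R : realType) (u : R -> R -> R) (a b c K M : R) :
    (forall x y, a <= x <= b -> u x y <= M) ->
    (forall x x' y, a <= x <= b -> a <= x' <= b ->
       u x y - u x' y <= K * `|x - x'|) ->
    (forall x y h, 0 < h <= 1 -> a <= x - h -> x + h <= b ->
       - (K * h ^+ 3) <=
       u (x + h) y + u (x - h) y + u x (y + h) + u x (y - h) - 4 * u x y) ->
    (forall y, u a y <= c) -> (forall y, u b y <= c) ->
  forall x y, a <= x <= b -> u x y <= c.
Proof.
move=> uM uL uD ua ub x0 y0 x0ab; rewrite leNgt; apply/negP => cu.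
wlog K0 : K uL uD / 0 < K.
  move=> W; apply: (W (`|K| + 1)) => [x x' y hx hx'|x y h h01 h1 h2|].
  - apply: le_trans (uL _ _ _ hx hx') _.
    by apply: ler_wpM2r => //; rewrite (le_trans (ler_norm _)) // lerDl.
  - apply: le_trans (uD _ _ _ h01 h1 h2); rewrite lerN2 ler_wpM2r //.
      by case/andP: h01 => h0 _; rewrite exprn_ge0 // ltW.
    by rewrite (le_trans (ler_norm _)) // lerDl.
  - by rewrite ltr_wpDl.
set d := u x0 y0 - c.
have d0 : 0 < d by rewrite subr_gt0.
set B := a ^+ 2 + b ^+ 2 + 1.
have B0 : 0 < B by rewrite ltr_wpDl // addr_ge0 // sqr_ge0.
have xB x : a <= x <= b -> x ^+ 2 <= B.
  case/andP=> h1 h2; have := sqr_ge0 a; have := sqr_ge0 b; rewrite /B.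
  by have [x0'|x0'] := leP 0 x; nra.
(* On the strip eps x^2 <= d / 4. *)
set eps := d / (4 * B).
have eps0 : 0 < eps by rewrite divr_gt0 // mulr_gt0.
have epsB : eps * B = d / 4 by rewrite /eps; field; rewrite gt_eqF.
pose v x y := u x y + eps * x ^+ 2.
pose E := [set r | exists x y, a <= x <= b /\ r = v x y].
have Esup : has_sup E.
  split; first by exists (v x0 y0), x0, y0.
  exists (M + eps * B) => _ [x [y [hx ->]]].
  exact: lerD (uM _ _ hx) (ler_wpM2l (ltW eps0) (xB _ hx)).
have Eub x y : a <= x <= b -> v x y <= sup E.
  by move=> hx; apply: ub_le_sup; [case: Esup | exists x, y].
have S0 : c + d <= sup E.
  have := Eub _ y0 x0ab; apply: le_trans.
  have : 0 <= eps * x0 ^+ 2 by rewrite mulr_ge0 ?sqr_ge0 ?ltW.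
  by rewrite /v /d; lra.
pose h := Num.min 1 (Num.min (eps / K) (d / (4 * K))).
have h0 : 0 < h by rewrite !lt_min ltr01 !divr_gt0 // mulr_gt0.
have h1 : h <= 1 by rewrite ge_min lexx.
have hK1 : K * h <= eps.
  have : h <= eps / K by rewrite !ge_min lexx orbT.
  by rewrite ler_pdivlMr // mulrC.
have hK2 : K * h <= d / 4.
  have : h <= d / (4 * K) by rewrite !ge_min lexx !orbT.
  by rewrite ler_pdivlMr ?mulr_gt0 //; lra.
pose eta := Num.min (d / 4) (eps * h ^+ 2 / 4).
have eta0 : 0 < eta by rewrite lt_min !divr_gt0 // mulr_gt0 // exprn_gt0.
have eta1 : eta <= d / 4 by rewrite ge_min lexx.
have eta2 : eta * 4 <= eps * h ^+ 2.
  by rewrite -ler_pdivlMr // ge_min lexx orbT.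
have [_ [x [y [xab ->]]] hv] := sup_adherent eta0 Esup.
have hx2 : eps * x ^+ 2 <= d / 4.
  by rewrite -epsB; apply: ler_wpM2l (xB _ xab); exact: ltW.
have aab : a <= a <= b by case/andP: xab; lra.
have bab : a <= b <= b by case/andP: xab; lra.
have bd t : a <= t <= b -> u t y <= c -> `|x - t| <= h -> False.
  move=> tab ut xt.
  have := uL _ _ y xab tab; have : K * `|x - t| <= K * h := ler_wpM2l (ltW K0) xt.
  by move: hv; rewrite /v; lra.
have [xa|xa] := ltP (x - h) a.
  apply: (bd a) => //; case/andP: xab => ? ?.
  by rewrite ger0_norm; lra.
have [xb|xb] := ltP b (x + h).
  apply: (bd b) => //; case/andP: xab => ? ?.
  by rewrite ler0_norm; lra.
have h01 : 0 < h <= 1 by rewrite h0.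
have := uD x y h h01 xa xb.
have l1 : v (x + h) y <= sup E by apply: Eub; case/andP: xab; lra.
have l2 : v (x - h) y <= sup E by apply: Eub; case/andP: xab; lra.
have l3 := Eub _ (y + h) xab.
have l4 := Eub _ (y - h) xab.
have : K * h ^+ 3 <= eps * h ^+ 2.
  by rewrite exprS mulrA ler_wpM2r // sqr_ge0.
have : 0 < eps * h ^+ 2 by rewrite mulr_gt0 // exprn_gt0.
have e1 : eps * (x + h) ^+ 2 + eps * (x - h) ^+ 2 =
  2 * (eps * x ^+ 2) + 2 * (eps * h ^+ 2) by ring.
move: l1 l2 l3 l4 hv e1; rewrite /v; lra.
Qed.

(** * The inequality for one-parameter groups in an algebra with a trace *)

Section Abstract.
Context (R : realType) (A : algType R[i]).
Context (star : A -> A) (N : A -> R) (tau : A -> R).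
Implicit Types (x y : A) (z w h : R[i]).

(** What the argument uses of the algebra and of [tau], the real part of its trace.
    The seminorm [N] only measures remainders of expansions, so that any
    submultiplicative seminorm that bounds [tau] will do: the C*-norm, or the sum
    of the moduli of the entries of a matrix. *)
Record tracial_functional : Prop := TracialFunctional {
  seminormD : forall x y, N (x + y) <= N x + N y;
  seminormZ : forall z x, N (z *: x) <= cabs z * N x;
  seminormM : forall x y, N (x * y) <= N x * N y;
  involB : forall x y, star (x - y) = star x - star y;
  involM : forall x y, star (x * y) = star y * star x;
  involK : forall x, star (star x) = x;
  tauB : forall x y, tau (x - y) = tau x - tau y;
  tauC : forall x y, tau (x * y) = tau (y * x);
  tau_invol : forall x, tau (star x) = tau x;
  tau_ge0 : forall x, 0 <= tau (star x * x);
  tau_eq0 : forall x, tau (star x * x) = 0 -> x = 0;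
  tau_bounded : exists2 K, 0 <= K & forall x, `|tau x| <= K * N x
}.

(** What the argument uses of the family [z |-> a^z].  Boundedness on the strip
    [0 <= Re z <= 1] holds because [a^(iy)] is unitary; the coefficients of the
    expansion at [0] are [log a] and [(log a)^2 / 2]. *)
Record complex_powers (a : R[i] -> A) : Prop := ComplexPowers {
  powersD : forall z w, a (z + w) = a z * a w;
  powers0 : a 0 = 1;
  powers_invol : forall z, star (a z) = a z^*;
  powers_bounded : exists K, forall z, 0 <= complex.Re z <= 1 -> N (a z) <= K;
  powers_taylor : exists l1 l2 K, forall h, cabs h <= 1 ->
    N (a h - (1 + h *: l1 + h ^+ 2 *: l2)) <= K * cabs h ^+ 3;
  powers_comm : forall x z, x * a 1 = a 1 * x -> x * a z = a z * x
}.

Context (T : tracial_functional).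

Lemma seminorm0 : N 0 = 0.
Proof.
apply/eqP; rewrite eq_le; apply/andP; split.
  by have := seminormZ T 0 0; rewrite scale0r cabs0 mul0r.
by have := seminormD T 0 0; rewrite addr0; lra.
Qed.

Lemma seminormN x : N (- x) <= N x.
Proof. by have := seminormZ T (-1) x; rewrite scaleN1r cabsN cabs1 mul1r. Qed.

Lemma seminormB x y : N (x - y) <= N x + N y.
Proof. by apply: le_trans (seminormD T _ _) _; rewrite lerD2l seminormN. Qed.

Lemma seminorm_ge0 x : 0 <= N x.
Proof. by have := seminormB x x; rewrite subrr seminorm0; lra. Qed.

Lemma tauN x : tau (- x) = - tau x.
Proof.
have t0 : tau 0 = 0 by rewrite -[X in tau X](subrr 0) tauB // subrr.
by rewrite -sub0r tauB // t0 sub0r.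
Qed.

Lemma tauD x y : tau (x + y) = tau x + tau y.
Proof. by rewrite -{1}[y]opprK tauB // tauN opprK. Qed.

Lemma seminormM_le x y (k l : R) : N x <= k -> N y <= l -> N (x * y) <= k * l.
Proof.
by move=> hx hy; apply: le_trans (seminormM T _ _) (ler_pM _ _ hx hy);
  exact: seminorm_ge0.
Qed.

Lemma seminormZ_le z x (k l : R) : cabs z <= k -> N x <= l -> N (z *: x) <= k * l.
Proof.
move=> hx hy; apply: le_trans (seminormZ T _ _) (ler_pM _ _ hx hy).
  exact: cabs_ge0.
exact: seminorm_ge0.
Qed.

Lemma seminormD_le x y (k l : R) : N x <= k -> N y <= l -> N (x + y) <= k + l.
Proof. by move=> hx hy; apply: le_trans (seminormD T _ _) (lerD hx hy). Qed.

(** ** Second-order expansions *)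

(** One constant controls both the coefficients and the remainder, so that
    uniformity over a family of functions is a statement about one number. *)
Definition taylor2 (f : R[i] -> A) (K : R) := exists f0 f1 f2,
  [/\ N f0 <= K, N f1 <= K, N f2 <= K & forall h, cabs h <= 1 ->
    N (f h - (f0 + h *: f1 + h ^+ 2 *: f2)) <= K * cabs h ^+ 3].

Lemma taylor2_ge0 f K : taylor2 f K -> 0 <= K.
Proof. by case=> f0 [f1 [f2 [h _ _ _]]]; apply: le_trans h; exact: seminorm_ge0. Qed.

Lemma taylor2_cst x K : N x <= K -> taylor2 (fun=> x) K.
Proof.
move=> xK; have K0 : 0 <= K := le_trans (seminorm_ge0 x) xK.
exists x, 0, 0; rewrite seminorm0; split=> // h _.
by rewrite !scaler0 !addr0 subrr seminorm0 mulr_ge0 // exprn_ge0 // cabs_ge0.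
Qed.

Lemma taylor2_product (f0 f1 f2 g0 g1 g2 : A) h :
  (f0 + h *: f1 + h ^+ 2 *: f2) * (g0 + h *: g1 + h ^+ 2 *: g2) =
  (f0 * g0 + h *: (f0 * g1 + f1 * g0) +
     h ^+ 2 *: (f0 * g2 + f1 * g1 + f2 * g0)) +
  h ^+ 3 *: (f1 * g2 + f2 * g1 + h *: (f2 * g2)).
Proof.
rewrite !(mulrDl, mulrDr, scalerDr) -!(scalerAl, scalerAr) !scalerA.
rewrite -?exprD -?exprS -?exprSr -?expr2 !addrA.
by rewrite [LHS](ACl (1*2*4*3*5*7*6*8*9)).
Qed.

Lemma taylor2M f g K L : taylor2 f K -> taylor2 g L ->
  taylor2 (fun h => f h * g h) (10 * (K * L)).
Proof.
move=> tf tg; have K0 := taylor2_ge0 tf; have L0 := taylor2_ge0 tg.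
have KL0 : 0 <= K * L by rewrite mulr_ge0.
have [f0 [f1 [f2 [F0 F1 F2 fR]]]] := tf.
have [g0 [g1 [g2 [G0 G1 G2 gR]]]] := tg.
exists (f0 * g0), (f0 * g1 + f1 * g0), (f0 * g2 + f1 * g1 + f2 * g0).
have H00 := seminormM_le F0 G0; have H01 := seminormM_le F0 G1.
have H10 := seminormM_le F1 G0; have H02 := seminormM_le F0 G2.
have H11 := seminormM_le F1 G1; have H20 := seminormM_le F2 G0.
have H12 := seminormM_le F1 G2; have H21 := seminormM_le F2 G1.
have H22 := seminormM_le F2 G2.
split=> [|||h h1].
- lra.
- have := seminormD_le H01 H10; lra.
- have := seminormD_le (seminormD_le H02 H11) H20; lra.
have c0 := cabs_ge0 h; set t := cabs h in h1 c0 *.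
have t2 : t ^+ 2 <= 1 by rewrite exprn_ile1.
have t3 : t ^+ 3 <= 1 by rewrite exprn_ile1.
have t30 : 0 <= t ^+ 3 by rewrite exprn_ge0.
set pf := f0 + h *: f1 + h ^+ 2 *: f2; set pg := g0 + h *: g1 + h ^+ 2 *: g2.
have Epf : N pf <= 3 * K.
  have h2 : cabs (h ^+ 2) <= 1 by rewrite cabsX.
  by have := seminormD_le (seminormD_le F0 (seminormZ_le h1 F1))
    (seminormZ_le h2 F2); rewrite -/pf; lra.
have Epg : N pg <= 3 * L.
  have h2 : cabs (h ^+ 2) <= 1 by rewrite cabsX.
  by have := seminormD_le (seminormD_le G0 (seminormZ_le h1 G1))
    (seminormZ_le h2 G2); rewrite -/pg; lra.
have Ef : N (f h) <= 4 * K.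
  have := seminormD_le (fR h h1) Epf; rewrite subrK.
  by have := ler_wpM2l K0 t3; rewrite -/t; lra.
have -> : f h * g h - (f0 * g0 + h *: (f0 * g1 + f1 * g0) +
    h ^+ 2 *: (f0 * g2 + f1 * g1 + f2 * g0)) =
  f h * (g h - pg) + (f h - pf) * pg +
  h ^+ 3 *: (f1 * g2 + f2 * g1 + h *: (f2 * g2)).
  rewrite -(addrK (h ^+ 3 *: (f1 * g2 + f2 * g1 + h *: (f2 * g2)))
    (f0 * g0 + _ + _)) -taylor2_product -/pf -/pg opprB addrA addrAC.
  by congr (_ + _); rewrite mulrBr mulrBl addrA subrK.
have h3 : cabs (h ^+ 3) <= t ^+ 3 by rewrite cabsX.
have := seminormD_le (seminormD_le (seminormM_le Ef (gR h h1))
  (seminormM_le (fR h h1) Epg))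
  (seminormZ_le h3 (seminormD_le (seminormD_le H12 H21) (seminormZ_le h1 H22))).
rewrite -/t; move/le_trans; apply; rewrite -subr_ge0 le_eqVlt.
by apply/orP; left; apply/eqP; ring.
Qed.

Lemma taylor2N f K : taylor2 f K -> taylor2 (fun h => f (- h)) K.
Proof.
case=> f0 [f1 [f2 [F0 F1 F2 fR]]]; exists f0, (- f1), f2.
split=> // [|h h1]; first exact: le_trans (seminormN f1) F1.
by have := fR (- h); rewrite cabsN sqrrN scalerN scaleNr; apply.
Qed.

Section Functional.
Context (k : R) (k0 : 0 <= k) (tau_le : forall x, `|tau x| <= k * N x).

Lemma taylor2_bounded f K : taylor2 f K -> tau (f 0) <= k * K.
Proof.
case=> f0 [f1 [f2 [F0 F1 F2 fR]]].
have := fR 0; rewrite cabs0 !expr0n /= mulr0 !scale0r !addr0 => /(_ ler01) h.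
apply: le_trans (ler_norm _) _; apply: le_trans (tau_le _) _; apply: (ler_wpM2l k0).
by have := seminormD_le h F0; rewrite subrK add0r.
Qed.

Lemma taylor2_lipschitz f K h : taylor2 f K -> cabs h <= 1 ->
  tau (f h) - tau (f 0) <= 3 * k * K * cabs h.
Proof.
move=> tf; have K0 := taylor2_ge0 tf.
case: tf => f0 [f1 [f2 [F0 F1 F2 fR]]] h1.
have := fR 0; rewrite cabs0 !expr0n /= mulr0 !scale0r !addr0 => /(_ ler01) e0.
rewrite -(tauB T); apply: le_trans (ler_norm _) _; apply: le_trans (tau_le _) _.
have -> : 3 * k * K * cabs h = k * (3 * K * cabs h) by ring.
apply: (ler_wpM2l k0).
have c0 := cabs_ge0 h; set t := cabs h in h1 c0 *.
have h2 : cabs (h ^+ 2) <= t by rewrite cabsX; apply: ler_iXnr.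
have E (x y z w : A) : x - w = x - (y + z) + z - (w - y).
  by rewrite opprB opprD !addrA !subrK.
rewrite (E _ f0 (h *: f1 + h ^+ 2 *: f2)) [f0 + (_ + _)]addrA.
apply: le_trans (seminormB _ _) _.
have t3 : t ^+ 3 <= t by apply: ler_iXnr.
have b := seminormD_le (fR h h1) (seminormD_le (seminormZ_le (lexx (cabs h)) F1)
  (seminormZ_le h2 F2)).
apply: le_trans (lerD b e0) _.
have := ler_wpM2l K0 t3; rewrite -/t; lra.
Qed.

(** The four points [h], [-h], [ih], [-ih] have zero sum and zero sum of squares:
    this is where the Cauchy-Riemann equations enter. *)
Lemma taylor2_laplacian f K (h : R) : taylor2 f K -> 0 < h <= 1 ->
  - (4 * k * K * h ^+ 3) <= tau (f h%:C%C) + tau (f (- h%:C%C)) +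
    tau (f ('i * h%:C)%C) + tau (f (- ('i * h%:C)%C)) - 4 * tau (f 0).
Proof.
case=> f0 [f1 [f2 [F0 F1 F2 fR]]] /andP[h0 h1].
have e0 : tau (f 0) = tau f0.
  apply/eqP; rewrite -subr_eq0 -(tauB T) -normr_le0.
  apply: le_trans (tau_le _) _; rewrite -[X in _ <= X](mulr0 k).
  apply: (ler_wpM2l k0); have := fR 0.
  by rewrite cabs0 !expr0n /= mulr0 !scale0r !addr0; apply.
pose t z := tau (z *: f1); pose s z := tau (z *: f2).
have tauS z : cabs z <= 1 ->
    - (k * (K * cabs z ^+ 3)) <= tau (f z) - (tau f0 + t z + s (z ^+ 2)).
  move=> hz; rewrite /t /s -!tauD -tauB // lerNl.
  apply: le_trans (ler_norm _) _; rewrite normrN.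
  apply: le_trans (tau_le _) _; apply: (ler_wpM2l k0); exact: fR.
have hh : cabs h%:C%C = h by rewrite cabs_real ger0_norm ?ltW.
have hi : cabs ('i * h%:C)%C = h by rewrite cabsM cabs_i mul1r.
have hh1 : cabs h%:C%C <= 1 by rewrite hh.
have hi1 : cabs ('i * h%:C)%C <= 1 by rewrite hi.
have := tauS _ hh1.
have := tauS (- h%:C%C); rewrite cabsN => /(_ hh1).
have := tauS _ hi1.
have := tauS (- ('i * h%:C)%C); rewrite cabsN => /(_ hi1).
rewrite hh hi !sqrrN exprMn sqr_i mulN1r e0.
have tN z : t (- z) = - t z by rewrite /t scaleNr tauN.
have sN z : s (- z) = - s z by rewrite /s scaleNr tauN.
rewrite !tN !sN; lra.
Qed.
End Functional.

(** ** The Heinz-type mean of two families of powers *)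

Section Heinz.
Context (a b : R[i] -> A) (Pa : complex_powers a) (Pb : complex_powers b).

Definition heinz z := tau (a z * b z * a (1 - z) * b (1 - z)).

(** Cyclicity of the trace; it reduces the line [Re z = 3/4] to [Re z = 1/4]. *)
Lemma heinz_sym z : heinz (1 - z) = heinz z.
Proof.
have e : 1 - (1 - z) = z by ring.
by rewrite /heinz e -mulrA tauC // mulrA.
Qed.

(** Cauchy-Schwarz for the trace, in the form given by the inequality between
    the arithmetic and the geometric mean. *)
Lemma tauM_le x y : 2 * tau (x * y) <= tau (x * star x) + tau (star y * y).
Proof.
have := tau_ge0 T (star x - y).
rewrite involB // involK // mulrBr !mulrBl !tauB //.
have -> : tau (star y * star x) = tau (x * y) by rewrite -involM // tau_invol.
lra.
Qed.

Let half : R[i] := 2^-1.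
Let m := tau (a half * b half * (a half * b half)).

Let halfD : half + half = 1. Proof. by rewrite /half; field. Qed.
Let halfJ : half^* = half. Proof. by rewrite /half fmorphV rmorph_nat. Qed.

(** With [X = A^(1/2) B^(1/2)], [tau (A B) = tau (X^* X)] and [m = tau (X X)], so
    that their difference measures [X - X^*], the commutator of [A^(1/2)] and [B^(1/2)]. *)
Lemma heinz_mid_sq : tau (star (a half * b half - b half * a half) *
  (a half * b half - b half * a half)) = 2 * (tau (a 1 * b 1) - m).
Proof.
rewrite involB // !involM // !(powers_invol Pa, powers_invol Pb) halfJ.
rewrite mulrBr !mulrBl !tauB // -!mulrA.
have -> : tau (b half * (a half * (a half * b half))) = tau (a 1 * b 1).
  by rewrite tauC // -!mulrA -(powersD Pb) mulrA -(powersD Pa) halfD.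
have -> : tau (a half * (b half * (b half * a half))) = tau (a 1 * b 1).
  by rewrite tauC // -!mulrA -(powersD Pa) mulrA -(powersD Pb) halfD tauC.
rewrite /m -mulrA [tau (b half * _)]tauC // -!mulrA; ring.
Qed.

Lemma heinz_mid_le : m <= tau (a 1 * b 1).
Proof.
have := tau_ge0 T (a half * b half - b half * a half).
by rewrite heinz_mid_sq; lra.
Qed.

Lemma heinz_mid_eq : m = tau (a 1 * b 1) -> a 1 * b 1 = b 1 * a 1.
Proof.
move=> e; have /(tau_eq0 T)/eqP : tau (star (a half * b half - b half * a half) *
  (a half * b half - b half * a half)) = 0 by rewrite heinz_mid_sq e subrr mulr0.
rewrite subr_eq0 => /eqP c; rewrite -halfD (powersD Pa) (powersD Pb).
have cb : GRing.comm (a half) (b half * b half) by exact: commrM.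
by apply: commr_sym; apply: commrM; exact: commr_sym.
Qed.

(** On the line [Re z = 1/4] the trace splits as [tau (P * Q)] with
    [tau (Q^* Q) = tau (A B)], and a second application of Cauchy-Schwarz
    bounds [tau (P P^* )] by the value [m] of the mean at [1/2]. *)
Lemma heinz_quarter z : complex.Re z = 4^-1 -> 2 * heinz z <= m + tau (a 1 * b 1).
Proof.
move=> rz; pose q : R[i] := 4^-1; pose w := 1 - z - q.
(* Re w = 1/2 and A^q A^w = A^(1-z): this splits A^(1-z) and B^(1-z) between P and Q. *)
have qq : q + q = half by rewrite /q /half; field.
have qJ : q^* = q by rewrite /q fmorphV rmorph_nat.
have zJ : z + z^* = half.
  rewrite -qq; have -> : q = (4^-1)%:C%C by rewrite rmorphV ?unitfE // rmorph_nat.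
  by case: z rz {w} => x y /= ->; apply/eqP; rewrite eq_complex /= subrr addr0 !eqxx.
have wJ : w + w^* = 1.
  have -> : w^* = 1 - z^* - q by rewrite /w !rmorphB rmorph1 /= qJ.
  rewrite /w.
  have -> : 1 - z - q + (1 - z^* - q) = (1 + 1) - (z + z^*) - (q + q) by ring.
  by rewrite zJ qq -addrA -opprD halfD addrK.
have wq : q + w = 1 - z by rewrite /w; ring.
have wq' : w + q = 1 - z by rewrite addrC.
pose P := b q * a z * b z * a q; pose Q := a w * b w.
have := tauM_le P Q.
have -> : tau (P * Q) = heinz z.
  rewrite /P /Q /heinz -!mulrA tauC // -!mulrA -(powersD Pb) wq'.
  by rewrite (mulrA (a q)) -(powersD Pa) wq.
have -> : tau (star Q * Q) = tau (a 1 * b 1).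
  rewrite /Q involM // (powers_invol Pa) (powers_invol Pb) tauC // -!mulrA.
  rewrite (mulrA (b w)) -(powersD Pb) wJ mulrA tauC // mulrA -(powersD Pa).
  by rewrite addrC wJ.
pose X := a z^* * b half * a z; pose Y := b z * a half * b z^*.
have -> : tau (P * star P) = tau (X * Y).
  rewrite /P /X /Y !involM // !(powers_invol Pa, powers_invol Pb) qJ -!mulrA.
  rewrite tauC // [in RHS]tauC // -!mulrA -qq !(powersD Pa, powersD Pb) -!mulrA.
  by rewrite [in RHS]tauC // -!mulrA [in RHS]tauC // -!mulrA.
have := tauM_le X Y.
have zJ' : z^* + z = half by rewrite addrC.
have -> : tau (X * star X) = m.
  rewrite /X !involM // !(powers_invol Pa, powers_invol Pb) halfJ conjCK -!mulrA.
  rewrite (mulrA (a z)) -(powersD Pa) zJ tauC // -!mulrA -(powersD Pa) zJ.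
  by rewrite /m tauC // -!mulrA.
have -> : tau (star Y * Y) = m.
  rewrite /Y !involM // !(powers_invol Pa, powers_invol Pb) halfJ conjCK -!mulrA.
  rewrite (mulrA (b z^*)) -(powersD Pb) zJ' tauC // -!mulrA -(powersD Pb) zJ'.
  by rewrite /m -!mulrA.
lra.
Qed.

(** The constants in the expansions of [z |-> A^z B^z A^(1-z) B^(1-z)] do not
    depend on the imaginary part of the base point, because purely imaginary
    powers are bounded. *)
Lemma heinz_taylor : exists K, forall z, 0 <= complex.Re z <= 1 ->
  taylor2 (fun h => a (z + h) * b (z + h) * a (1 - (z + h)) * b (1 - (z + h))) K.
Proof.
have expansion c : complex_powers c -> exists K, forall z, 0 <= complex.Re z <= 1 ->
    taylor2 (fun h => c (z + h)) K.
  move=> Pc; have [K cK] := powers_bounded Pc.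
  have [l1 [l2 [L cL]]] := powers_taylor Pc.
  have [M tM] : exists M, taylor2 c M.
    pose M := `|N 1| + `|N l1| + `|N l2| + `|L|.
    have n1 := normr_ge0 (N 1); have n2 := normr_ge0 (N l1).
    have n3 := normr_ge0 (N l2); have n4 := normr_ge0 L.
    exists M, 1, l1, l2; rewrite /M.
    split=> [|||h h1].
    - by have := ler_norm (N 1); lra.
    - by have := ler_norm (N l1); lra.
    - by have := ler_norm (N l2); lra.
    apply: le_trans (cL h h1) _; apply: ler_wpM2r; first by rewrite exprn_ge0 // cabs_ge0.
    by have := ler_norm L; lra.
  exists (10 * (K * M)) => z z1.
  have := taylor2M (taylor2_cst (cK z z1)) tM.
  by congr taylor2; apply/funext => h; rewrite (powersD Pc).
have [Ka ta] := expansion a Pa; have [Kb tb] := expansion b Pb.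
eexists=> z z1.
have z1' : 0 <= complex.Re (1 - z) <= 1 by rewrite raddfB /=; lra.
have := taylor2M (taylor2M (taylor2M (ta z z1) (tb z z1)) (taylor2N (ta _ z1')))
  (taylor2N (tb _ z1')).
by congr taylor2; apply/funext => h; rewrite opprD addrA.
Qed.

(** The mean of [m] and [tau (A B)] bounds both boundary lines, hence the strip. *)
Theorem heinz_strip z : 4^-1 <= complex.Re z <= 3 / 4 ->
  heinz z <= (m + tau (a 1 * b 1)) / 2.
Proof.
have [K tK] := heinz_taylor; have [k k0 tauk] := tau_bounded T.
pose u (x y : R) := heinz (x +i* y)%C.
have hz w h : heinz (w + h) = tau (a (w + h) * b (w + h) * a (1 - (w + h)) * b (1 - (w + h))).
  by [].
have hz0 w : heinz w = tau (a (w + 0) * b (w + 0) * a (1 - (w + 0)) * b (1 - (w + 0))).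
  by rewrite addr0.
have line (y : R) : 2 * u 4^-1 y <= m + tau (a 1 * b 1) by exact: heinz_quarter.
suff U (x y : R) : 4^-1 <= x <= 3 / 4 -> u x y <= (m + tau (a 1 * b 1)) / 2.
  by case: z => x y /= h; exact: U.
apply: (@strip_maximum_principle _ _ _ _ _ (Num.max (3 * k * K) (4 * k * K)) (k * K)).
- move=> {}x {}y hx; rewrite /u hz0.
  have x1 : 0 <= complex.Re (x +i* y)%C <= 1 by move: hx => /=; lra.
  exact: taylor2_bounded k0 tauk _ _ (tK _ x1).
- move=> {}x x' {}y hx hx'; rewrite /u.
  have -> : (x +i* y = (x' +i* y) + (x - x')%:C)%C.
    by apply/eqP; rewrite eq_complex /= addr0 eqxx addrC subrK eqxx.
  rewrite [X in _ - X]hz0 -cabs_real.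
  have x1 : cabs (x - x')%:C%C <= 1 by rewrite cabs_real ler_norml; lra.
  have x'1 : 0 <= complex.Re (x' +i* y)%C <= 1 by move: hx' => /=; lra.
  have := taylor2_lipschitz k0 tauk (tK _ x'1) x1; move/le_trans; apply.
  by apply: ler_wpM2r; rewrite ?cabs_ge0 // le_max lexx.
- move=> {}x {}y h h01 hx hx'; rewrite /u.
  have x1 : 0 <= complex.Re (x +i* y)%C <= 1 by case/andP: h01 => /=; lra.
  have := taylor2_laplacian k0 tauk (tK _ x1) h01.
  rewrite -!hz addr0.
  have -> : ((x +i* y) + h%:C = (x + h) +i* y)%C.
    by apply/eqP; rewrite eq_complex /= addr0 !eqxx.
  have -> : ((x +i* y) - h%:C = (x - h) +i* y)%C.
    by apply/eqP; rewrite eq_complex /= oppr0 addr0 !eqxx.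
  have -> : ((x +i* y) + 'i * h%:C = x +i* (y + h))%C.
    by apply/eqP; rewrite eq_complex /=; apply/andP; split; apply/eqP; ring.
  have -> : ((x +i* y) - 'i * h%:C = x +i* (y - h))%C.
    by apply/eqP; rewrite eq_complex /=; apply/andP; split; apply/eqP; ring.
  apply: le_trans; rewrite lerN2; apply: ler_wpM2r.
    by rewrite exprn_ge0 //; case/andP: h01 => /ltW.
  by rewrite le_max lexx orbT.
- by move=> {}y; rewrite ler_pdivlMr // mulrC.
- move=> {}y; rewrite /u -heinz_sym ler_pdivlMr // mulrC.
  have -> : (1 - (3 / 4 +i* y) = 4^-1 +i* - y)%C; last exact: line.
  by apply/eqP; rewrite eq_complex /= sub0r eqxx andbT; apply/eqP; field.
Qed.

(** Equality in the strip forces [tau (A B) <= m], which is the equality case of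
    [heinz_mid_le]. *)
Theorem heinz_equality :
    (exists z, 4^-1 <= complex.Re z <= 3 / 4 /\ heinz z = tau (a 1 * b 1)) ->
  a 1 * b 1 = b 1 * a 1 /\ forall z, heinz z = tau (a 1 * b 1).
Proof.
case=> z0 [hz0 e0].
have ab : a 1 * b 1 = b 1 * a 1.
  by apply: heinz_mid_eq; have := heinz_strip hz0; have := heinz_mid_le; rewrite e0; lra.
split=> // z; rewrite /heinz.
have ba w : b 1 * a w = a w * b 1 by apply: (powers_comm Pa); rewrite ab.
have comm v w : a v * b w = b w * a v by apply: (powers_comm Pb); rewrite ba.
rewrite -(mulrA (a z)) -comm mulrA -(powersD Pa) -mulrA -(powersD Pb).
by rewrite addrC subrK.
Qed.

End Heinz.
End Abstract.

(** * The complex exponential and complex powers of positive numbers *)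

Section ComplexExponential.
Context (R : realType).
Implicit Types (z w : R[i]) (x y s t : R).

Lemma Re_realM x z : complex.Re (x%:C%C * z) = x * complex.Re z.
Proof. by case: z => a b /=; rewrite mul0r subr0. Qed.

Lemma cexpD z w : cexp (z + w) = cexp z * cexp w.
Proof.
case: z w => [a b] [c d]; rewrite /cexp /= expRD cosD sinD.
by apply/eqP; rewrite eq_complex /=; apply/andP; split; apply/eqP; ring.
Qed.

Lemma cexp0 : cexp 0 = 1 :> R[i].
Proof.
rewrite /cexp /= expR0 cos0 sin0.
by apply/eqP; rewrite eq_complex /=; apply/andP; split; apply/eqP; ring.
Qed.

Lemma cexp_conj z : cexp z^* = (cexp z)^*.
Proof.
case: z => a b; rewrite /cexp /= cosN sinN.
by apply/eqP; rewrite eq_complex /=; apply/andP; split; apply/eqP; ring.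
Qed.

Lemma cabs_cexp z : cabs (cexp z) = expR (complex.Re z).
Proof.
rewrite /cexp cabsM cabs_real ger0_norm ?expR_ge0 // /cabs normc_def /=.
by rewrite cos2Dsin2 sqrtr1 mulr1.
Qed.

Lemma cexp_real x : cexp x%:C%C = (expR x)%:C%C.
Proof.
rewrite /cexp /= cos0 sin0.
by apply/eqP; rewrite eq_complex /=; apply/andP; split; apply/eqP; ring.
Qed.

Lemma derive_bounded_le (f df : R -> R) (M : R) :
    (forall s, is_derive s 1 f (df s)) ->
    (forall s, 0 <= s <= 1 -> `|df s| <= M) ->
  forall s, 0 <= s <= 1 -> `|f s - f 0| <= M.
Proof.
move=> fd dM s /andP[s0 s1].
have [c c01 ->] : exists2 c, c \in `[0, s] & f s - f 0 = df c * (s - 0).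
  apply: MVT_segment => //.
  apply: derivable_within_continuous => x _; by case: (fd x).
move: c01; rewrite in_itv /= subr0 normrM => /andP[c0 cs].
have c1 : 0 <= c <= 1 by rewrite c0 (le_trans cs).
rewrite (ger0_norm s0); have := dM c c1; have := normr_ge0 (df c); nra.
Qed.

Section Taylor.
Context (w : R[i]).

(* Real parts along the segment from 0 to w; the multiplier z selects the real
   or the imaginary part and keeps track of the derivatives. *)
Let f z s : R := complex.Re (z * cexp (s%:C%C * w)).

Let f_derive z s : is_derive s 1 (f z) (f (z * w) s).
Proof.
rewrite /f /cexp; case: z w => [p q] [x y] /=.
apply: is_derive_eq.
by rewrite /GRing.scale /=; ring.
Qed.

Let f_bound z s : 0 <= s <= 1 -> `|f z s| <= cabs z * expR (cabs w).
Proof.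
move=> /andP[s0 s1]; apply: le_trans (cabs_Re _) _.
rewrite cabsM cabs_cexp ler_wpM2l ?cabs_ge0 // ler_expR.
rewrite Re_realM; have := cabs_Re w; have := ler_norm (complex.Re w); have := cabs_ge0 w; nra.
Qed.

Let e := expR (cabs w).

(* Each integration of the identity (f z)' = f (z w) yields one more term of the
   Taylor polynomial and one more factor w in the bound of the remainder. *)
Let f_bound1 z s : 0 <= s <= 1 -> `|f z s - f z 0| <= cabs (z * w) * e.
Proof. by apply: (derive_bounded_le (f_derive z)) => t; exact: f_bound. Qed.

Let f_bound2 z s : 0 <= s <= 1 ->
  `|f z s - (f z 0 + s * f (z * w) 0)| <= cabs (z * w * w) * e.
Proof.
pose g t := f z t - (f z 0 + t * f (z * w) 0).
have -> : f z s - (f z 0 + s * f (z * w) 0) = g s - g 0 by rewrite /g; ring.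
apply: (@derive_bounded_le g (fun t => f (z * w) t - f (z * w) 0)).
  move=> t; have ? := f_derive z t; rewrite /g; apply: is_derive_eq.
  by rewrite /GRing.scale /=; ring.
exact: f_bound1.
Qed.

Let f_bound3 z s : 0 <= s <= 1 ->
  `|f z s - (f z 0 + s * f (z * w) 0 + s ^+ 2 / 2 * f (z * w * w) 0)| <=
  cabs (z * w * w * w) * e.
Proof.
pose g t := f z t - (f z 0 + t * f (z * w) 0 + t ^+ 2 / 2 * f (z * w * w) 0).
have -> : f z s - (f z 0 + s * f (z * w) 0 + s ^+ 2 / 2 * f (z * w * w) 0) =
  g s - g 0 by rewrite /g; ring.
apply: (@derive_bounded_le g
  (fun t => f (z * w) t - (f (z * w) 0 + t * f (z * w * w) 0))).
  move=> t; have ? := f_derive z t; rewrite /g; apply: is_derive_eq.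
  by rewrite /GRing.scale /=; field.
exact: f_bound2.
Qed.

Let le01 : 0 <= (1 : R) <= 1. Proof. by rewrite ler01 lexx. Qed.

Let cabs_f z (c : R) : (forall v, cabs v = 1 -> `|complex.Re (v * z)| <= c) ->
  cabs z <= 2 * c.
Proof.
move=> h; apply: le_trans (cabs_le z) _.
have := h _ (cabs1 R); rewrite mul1r.
have := h _ (cabs_i R); rewrite mulrC ReiNIm normrN; lra.
Qed.

Let f0 z : f z 0 = complex.Re z.
Proof. by rewrite /f mul0r cexp0 mulr1. Qed.

Let f1 z : f z 1 = complex.Re (z * cexp w).
Proof. by rewrite /f mul1r. Qed.

Lemma cexp_lipschitz : cabs (cexp w - 1) <= 2 * (cabs w * e).
Proof.
apply: cabs_f => v v1; have := f_bound1 v le01.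
by rewrite f0 f1 cabsM v1 mul1r mulrBr mulr1 raddfB.
Qed.

Lemma cexp_taylor : cabs (cexp w - (1 + w + w ^+ 2 / 2)) <= 2 * (cabs w ^+ 3 * e).
Proof.
apply: cabs_f => v v1; have := f_bound3 v le01.
rewrite !f0 f1 !cabsM v1 !mul1r expr1n mul1r.
rewrite mulrBr raddfB /= !mulrDr !raddfD /= mulr1.
have -> : v * (w ^+ 2 / 2) = (2^-1)%:C%C * (v * w * w).
  by rewrite rmorphV ?unitfE //= rmorph_nat; field.
by rewrite Re_realM !exprS expr0 mulr1 !mulrA.
Qed.

End Taylor.

Lemma powfunD z w (t : R[i]) : powfun (z + w) t = powfun z t * powfun w t.
Proof. by rewrite /powfun mulrDl cexpD. Qed.

Lemma powfun0 (t : R[i]) : powfun 0 t = 1.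
Proof. by rewrite /powfun mul0r cexp0. Qed.

Lemma powfun1 t : 0 < t -> powfun 1 t%:C%C = t%:C%C.
Proof. by move=> t0; rewrite /powfun mul1r cexp_real /= lnK. Qed.

Lemma powfun_conj z (t : R[i]) : powfun z^* t = (powfun z t)^*.
Proof.
rewrite /powfun -cexp_conj rmorphM; congr (cexp (_ * _)).
by apply/eqP; rewrite eq_complex /= oppr0 !eqxx.
Qed.

Lemma cabs_powfun z (t : R[i]) :
  cabs (powfun z t) = expR (complex.Re z * ln (complex.Re t)).
Proof. by rewrite cabs_cexp; case: z => x y /=; rewrite mulr0 subr0. Qed.

Lemma powfun_bounded z (t : R[i]) (l : R) : `|ln (complex.Re t)| <= l ->
  0 <= complex.Re z <= 1 -> cabs (powfun z t) <= expR l.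
Proof.
move=> tl /andP[z0 z1]; rewrite cabs_powfun ler_expR.
have := ler_norm (ln (complex.Re t)); have := normr_ge0 (ln (complex.Re t)); nra.
Qed.

Lemma powfun_taylor (l : R) : exists K, forall h (t : R[i]),
  cabs h <= 1 -> `|ln (complex.Re t)| <= l ->
  cabs (powfun h t - (1 + h * (ln (complex.Re t))%:C%C +
    h ^+ 2 * ((ln (complex.Re t))%:C%C ^+ 2 / 2))) <= K * cabs h ^+ 3.
Proof.
exists (2 * (l ^+ 3 * expR l)) => h t h1 tl.
set y := ln (complex.Re t) in tl *; rewrite -[powfun h t]/(cexp (h * y%:C%C)).
have l0 : 0 <= l := le_trans (normr_ge0 _) tl.
have -> : h ^+ 2 * (y%:C%C ^+ 2 / 2) = (h * y%:C%C) ^+ 2 / 2 by rewrite exprMn mulrA.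
apply: le_trans (cexp_taylor _) _.
rewrite cabsM cabs_real.
have c0 := cabs_ge0 h; set c := cabs h in h1 c0 *.
have b1 : `|y| ^+ 3 <= l ^+ 3 by rewrite lerXn2r ?nnegrE.
have b2 : expR (c * `|y|) <= expR l.
  by rewrite ler_expR; have := normr_ge0 y; nra.
have b3 : `|y| ^+ 3 * expR (c * `|y|) <= l ^+ 3 * expR l.
  by apply: ler_pM; rewrite ?exprn_ge0 ?expR_ge0.
have c3 : 0 <= 2 * c ^+ 3 by rewrite mulr_ge0 // exprn_ge0.
by have := ler_wpM2l c3 b3; rewrite exprMn; lra.
Qed.

Lemma ln_lipschitz (m s t : R) : 0 < m -> m <= s -> m <= t ->
  `|ln s - ln t| <= `|s - t| / m.
Proof.
move=> m0; wlog st : s t / s <= t.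
  move=> W hs ht; have [st|/ltW ts] := leP s t; first exact: W.
  by rewrite distrC [X in _ <= X / _]distrC; exact: W.
move=> hs ht; have s0 := lt_le_trans m0 hs; have t0 := lt_le_trans m0 ht.
rewrite distrC ger0_norm ?subr_ge0 ?ler_ln ?posrE //.
rewrite distrC ger0_norm ?subr_ge0 // -ln_div ?posrE //.
have -> : t / s = 1 + (t - s) / s by field; rewrite gt_eqF.
have ts0 : 0 <= (t - s) / s by rewrite divr_ge0 ?subr_ge0 // ltW.
apply: le_trans (le_ln1Dx _) _; first by rewrite (lt_le_trans _ ts0) // ltrN10.
by rewrite ler_wpM2l ?subr_ge0 // lef_pV2 ?posrE.
Qed.

Lemma powfun_lipschitz z (m M : R) : 0 < m -> exists K, forall s t,
  m <= s <= M -> m <= t <= M ->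
  cabs (powfun z s%:C%C - powfun z t%:C%C) <= K * `|s - t|.
Proof.
move=> m0.
pose l := (M - m) / m.
exists (expR (`|complex.Re z| * (`|ln m| + l)) * (2 * (cabs z * m^-1 * expR (cabs z * l)))).
move=> s t /andP[s1 s2] /andP[t1 t2].
have st : `|s - t| / m <= l by rewrite ler_wpM2r ?invr_ge0 ?(ltW m0) // ler_norml; lra.
have lst := ln_lipschitz m0 s1 t1.
have tm : `|ln t| <= `|ln m| + l.
  have := ln_lipschitz m0 t1 (lexx m); have : `|t - m| / m <= l.
    by rewrite ler_wpM2r ?invr_ge0 ?(ltW m0) // ler_norml; lra.
  have := ler_distD 0 (ln t) 0; have := ler_normD (ln t - ln m) (ln m).
  rewrite subrK; lra.
have -> : powfun z s%:C%C - powfun z t%:C%C =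
    powfun z t%:C%C * (cexp (z * (ln s - ln t)%:C%C) - 1).
  rewrite mulrBr mulr1 /powfun -cexpD /=; congr (cexp _ - _).
  by rewrite -mulrDr -rmorphD /= addrC subrK.
rewrite cabsM cabs_powfun /= -[X in _ <= X]mulrA; apply: ler_pM.
- exact: expR_ge0.
- exact: cabs_ge0.
- rewrite ler_expR; apply: le_trans (ler_norm _) _.
  by rewrite normrM ler_wpM2l.
apply: le_trans (cexp_lipschitz _) _; rewrite cabsM cabs_real.
have c0 := cabs_ge0 z; set d := `|ln s - ln t| in lst *.
have b1 : expR (cabs z * d) <= expR (cabs z * l).
  by rewrite ler_expR ler_wpM2l // (le_trans lst).
have b2 : d * expR (cabs z * d) <= `|s - t| / m * expR (cabs z * l).
  by apply: ler_pM; rewrite ?normr_ge0 ?expR_ge0.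
have c2 : 0 <= 2 * cabs z by rewrite mulr_ge0.
by have := ler_wpM2l c2 b2; lra.
Qed.

End ComplexExponential.

(** * Uniform approximation by polynomials *)

Section Bernstein.
Context (R : realType).
Implicit Types (s x : R).

(** The Bernstein polynomial of order [n] of the sample values [h 0], ..., [h n],
    by de Casteljau's recursion: this makes it visibly an iterated mean. *)
Fixpoint bernstein_poly (n : nat) (h : nat -> R[i]) : {poly R[i]} :=
  if n is n'.+1 then
    (1 - 'X) * bernstein_poly n' h + 'X * bernstein_poly n' (fun k => h k.+1)
  else (h 0%N)%:P.

Fixpoint bernstein_mean (n : nat) (h : nat -> R) s : R :=
  if n is n'.+1 then
    (1 - s) * bernstein_mean n' h s + s * bernstein_mean n' (fun k => h k.+1) s
  else h 0%N.

Lemma bernstein_poly_le n (h : nat -> R[i]) (g : nat -> R) (c : R[i]) s :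
    0 <= s <= 1 -> (forall k, (k <= n)%N -> cabs (h k - c) <= g k) ->
  cabs ((bernstein_poly n h).[s%:C%C] - c) <= bernstein_mean n g s.
Proof.
move=> /andP[s0 s1]; elim: n h g => [|n ih] h g hg /=.
  by rewrite hornerC; exact: hg.
rewrite !hornerE.
set u := (bernstein_poly n h).[_]; set v := (bernstein_poly n _).[_].
have -> : (1 - s%:C%C) * u + s%:C%C * v - c =
    (1 - s)%:C%C * (u - c) + s%:C%C * (v - c) by rewrite rmorphB rmorph1; ring.
apply: le_trans (cabsD _ _) _; rewrite !cabsM !cabs_real !ger0_norm ?subr_ge0 //.
apply: lerD; apply: ler_wpM2l; rewrite ?subr_ge0 //; apply: ih => k kn.
  by apply: hg; exact: leqW.
exact: hg.
Qed.

(** The binomial law has variance [n s (1 - s)], to which the squared bias is added. *)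
Lemma bernstein_mean_sqr n s (al be c : R) :
  bernstein_mean n (fun k => al + be * (k%:R - c) ^+ 2) s =
  al + be * (n%:R * s * (1 - s) + (n%:R * s - c) ^+ 2).
Proof.
elim: n c => [|n ih] c /=; first by ring.
rewrite ih; under [X in bernstein_mean _ X _]eq_fun => k.
  have -> : k.+1%:R - c = k%:R - (c - 1) :> R by rewrite -natr1; ring.
  over.
by rewrite ih -natr1; ring.
Qed.

(** With [n = N^2] sample points the mean deviation of [k / n] from [s] is at
    most the standard deviation [1 / (2 N)]. *)
Lemma bernstein_approx (g : R -> R[i]) (L : R) (N : nat) :
    (0 < N)%N -> 0 <= L ->
    (forall s t, 0 <= s <= 1 -> 0 <= t <= 1 -> cabs (g s - g t) <= L * `|s - t|) ->
  forall s, 0 <= s <= 1 ->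
    cabs ((bernstein_poly (N ^ 2) (fun k => g (k%:R / (N ^ 2)%:R))).[s%:C%C] - g s)
      <= L / N%:R.
Proof.
move=> N0 L0 gL s s01; set n := (N ^ 2)%N.
have NR : 0 < N%:R :> R by rewrite ltr0n.
have nR : 0 < n%:R :> R by rewrite ltr0n expn_gt0 N0.
have nN : n%:R = N%:R ^+ 2 :> R by rewrite natrX.
pose al : R := L / n%:R * (N%:R / 2); pose be : R := L / n%:R / (2 * N%:R).
apply: (@le_trans _ _ (bernstein_mean n (fun k => al + be * (k%:R - n%:R * s) ^+ 2) s)).
  apply: bernstein_poly_le => // k kn.
  have k01 : 0 <= (k%:R / n%:R : R) <= 1.
    by rewrite divr_ge0 //= ler_pdivrMr // mul1r ler_nat.
  apply: le_trans (gL _ _ k01 s01) _.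
  have -> : k%:R / n%:R - s = (k%:R - n%:R * s) / n%:R by field; rewrite gt_eqF.
  set d := k%:R - n%:R * s; rewrite normrM (gtr0_norm (x := n%:R^-1)) ?invr_gt0 //.
  have h : `|d| <= N%:R / 2 + d ^+ 2 / (2 * N%:R).
    have : 0 <= (N%:R - `|d|) ^+ 2 / (2 * N%:R).
      by rewrite divr_ge0 ?sqr_ge0 // mulr_ge0 // ltW.
    have -> : (N%:R - `|d|) ^+ 2 / (2 * N%:R) =
      N%:R / 2 + `|d| ^+ 2 / (2 * N%:R) - `|d| by field; rewrite gt_eqF.
    by rewrite real_normK ?num_real // subr_ge0.
  have -> : al + be * d ^+ 2 = L / n%:R * (N%:R / 2 + d ^+ 2 / (2 * N%:R)).
    by rewrite /al /be; field; rewrite !gt_eqF.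
  by have := ler_wpM2l (divr_ge0 L0 (ltW nR)) h; lra.
rewrite bernstein_mean_sqr subrr expr0n addr0 /=.
have -> : al + be * (n%:R * s * (1 - s)) = L / N%:R * (1 / 2 + s * (1 - s) / 2).
  by rewrite /al /be nN; field; rewrite !gt_eqF.
have LN := divr_ge0 L0 (ltW NR).
have : 1 / 2 + s * (1 - s) / 2 <= 1 by case/andP: s01; nra.
by move/(ler_wpM2l LN); rewrite mulr1.
Qed.

(** Lipschitz functions are enough for the functions [ln] and [t |-> t^z] on a segment
    of positive numbers. *)
Lemma lipschitz_poly_approx (f : R -> R[i]) (m M L : R) : m < M ->
    (forall s t, m <= s <= M -> m <= t <= M -> cabs (f s - f t) <= L * `|s - t|) ->
  forall e, 0 < e -> exists p : {poly R[i]},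
    forall x, m <= x <= M -> cabs (p.[x%:C%C] - f x) < e.
Proof.
move=> mM fL e e0; have d0 : 0 < M - m by rewrite subr_gt0.
have mm : m <= m <= M by lra.
have MM : m <= M <= M by lra.
have L0 : 0 <= L.
  have := le_trans (cabs_ge0 _) (fL _ _ MM mm).
  by rewrite gtr0_norm // pmulr_lge0.
pose g s := f (m + s * (M - m)).
have gL s t : 0 <= s <= 1 -> 0 <= t <= 1 -> cabs (g s - g t) <= L * (M - m) * `|s - t|.
  move=> hs ht; apply: le_trans (fL _ _ _ _) _; [by nra|by nra|].
  have -> : m + s * (M - m) - (m + t * (M - m)) = (s - t) * (M - m) by ring.
  by rewrite normrM (gtr0_norm d0) [`|_| * _]mulrC mulrA.
have LM0 : 0 <= L * (M - m) by rewrite mulr_ge0 // ltW.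
have x0 : 0 <= L * (M - m) / e by rewrite divr_ge0 // ltW.
pose N := Num.bound (L * (M - m) / e).
have hN : L * (M - m) / e < N%:R := archi_boundP x0.
have NR : 0 < N%:R :> R := le_lt_trans x0 hN.
have N0 : (0 < N)%N by rewrite -(ltr0n R).
exists (bernstein_poly (N ^ 2) (fun k => g (k%:R / (N ^ 2)%:R)) \Po
  ((M - m)^-1%:C%C *: ('X - m%:C%C%:P))) => x hx.
pose s := (x - m) / (M - m).
have s01 : 0 <= s <= 1.
  by rewrite /s; apply/andP; split; [apply: divr_ge0; lra|rewrite ler_pdivrMr //; lra].
have -> : f x = g s by rewrite /g /s divfK ?gt_eqF // addrC subrK.
rewrite horner_comp hornerZ hornerXsubC -rmorphB -rmorphM mulrC -/s.
apply: le_lt_trans (bernstein_approx N0 LM0 gL s01) _.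
by rewrite ltr_pdivrMr // [e * _]mulrC -ltr_pdivrMr.
Qed.

End Bernstein.

(** * Norms, limits and inverses in a C*-algebra *)

Section CStarBasics.
Context (R : realType) (A : cstarType R).
Implicit Types (x y : A) (z w : R[i]) (e : R).

Definition nrm x : R := complex.Re (cstar_norm x).

Let cstar_norm0 : cstar_norm (0 : A) = 0.
Proof. by have := cstar_normZ 0 (0 : A); rewrite scale0r normr0 mul0r. Qed.

Lemma cstar_normE x : cstar_norm x = (nrm x)%:C%C.
Proof.
have h : 0 <= cstar_norm x.
  have := cstar_ler_normD x (- x); rewrite subrr cstar_norm0.
  have := cstar_normZ (-1) x; rewrite scaleN1r normrN1 mul1r => ->.
  by rewrite -mulr2n pmulrn_lge0.
by have [r r0 e] := ge0_complex h; rewrite /nrm e.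
Qed.

Lemma nrmD x y : nrm (x + y) <= nrm x + nrm y.
Proof. by rewrite -lecR rmorphD /= -!cstar_normE cstar_ler_normD. Qed.

Lemma nrmZ z x : nrm (z *: x) = cabs z * nrm x.
Proof. by apply: complexI; rewrite rmorphM /= -!cstar_normE cstar_normZ cabsE. Qed.

Lemma nrmM x y : nrm (x * y) <= nrm x * nrm y.
Proof. by rewrite -lecR rmorphM /= -!cstar_normE cstar_normM. Qed.

Lemma nrm_eq0 x : nrm x = 0 -> x = 0.
Proof. by move=> h; apply: cstar_norm0_eq0; rewrite cstar_normE h. Qed.

Lemma nrm_cstar x : nrm (star x * x) = nrm x ^+ 2.
Proof. by apply: complexI; rewrite rmorphXn /= -!cstar_normE cstar_identity. Qed.

Lemma nrm0 : nrm 0 = 0.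
Proof. by rewrite /nrm cstar_norm0. Qed.

Lemma nrmN x : nrm (- x) = nrm x.
Proof. by rewrite -scaleN1r nrmZ cabsN cabs1 mul1r. Qed.

Lemma nrmB x y : nrm (x - y) <= nrm x + nrm y.
Proof. by rewrite -(nrmN y) nrmD. Qed.

Lemma nrm_ge0 x : 0 <= nrm x.
Proof. by have := nrmB x x; rewrite subrr nrm0; lra. Qed.

Lemma nrm_gt0 x : (0 < nrm x) = (x != 0).
Proof.
rewrite lt_def nrm_ge0 andbT; congr (~~ _); apply/eqP/eqP => [|->].
  exact: nrm_eq0.
exact: nrm0.
Qed.

Lemma nrm_distC x y : nrm (x - y) = nrm (y - x).
Proof. by rewrite -nrmN opprB. Qed.

Lemma nrm_le0 x : (forall e, 0 < e -> nrm x <= e) -> x = 0.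
Proof.
move=> h; apply: nrm_eq0; apply/eqP; rewrite eq_le nrm_ge0 andbT.
by apply/ler_addgt0Pl => e e0; rewrite addr0 h.
Qed.

Lemma nrmM_le x y (k l : R) : nrm x <= k -> nrm y <= l -> nrm (x * y) <= k * l.
Proof.
by move=> hx hy; apply: le_trans (nrmM _ _) (ler_pM _ _ hx hy); exact: nrm_ge0.
Qed.

Lemma starD x y : star (x + y) = star x + star y.
Proof. by have := star_antilinear 1 x y; rewrite !scale1r rmorph1 scale1r. Qed.

Lemma star0 : star (0 : A) = 0.
Proof. by apply: (@addrI _ (star 0)); rewrite -starD !addr0. Qed.

Lemma starZ z x : star (z *: x) = z^* *: star x.
Proof. by have := star_antilinear z x 0; rewrite !addr0 star0 addr0. Qed.

Lemma starN x : star (- x) = - star x.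
Proof. by rewrite -scaleN1r starZ rmorphN rmorph1 scaleN1r. Qed.

Lemma starB x y : star (x - y) = star x - star y.
Proof. by rewrite starD starN. Qed.

Lemma star1 : star (1 : A) = 1.
Proof. by rewrite -[LHS]mulr1 -[X in _ * X]starK -starM mulr1 starK. Qed.

Lemma nrm_star x : nrm (star x) = nrm x.
Proof.
suff h y : nrm y <= nrm (star y) by apply: le_anti; rewrite h -{2}[x]starK h.
have [->|y0] := eqVneq y 0; first by rewrite nrm0 nrm_ge0.
have := nrmM (star y) y; rewrite nrm_cstar expr2 ler_pM2r // nrm_gt0 //.
Qed.

Lemma nrm1 : nrm 1 = 1.
Proof.
have : nrm 1 * nrm 1 = nrm 1 by have := nrm_cstar 1; rewrite star1 mulr1 expr2.
have : 0 < nrm 1 by rewrite nrm_gt0 oner_neq0.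
by move=> h /(canRL (mulfK (lt0r_neq0 h))) ->; rewrite divff // lt0r_neq0.
Qed.

(** ** Limits of sequences *)

Definition tends_to (u : nat -> A) (l : A) :=
  forall e, 0 < e -> exists N, forall n, (N <= n)%N -> nrm (u n - l) < e.

Lemma cauchy_tends_to (u : nat -> A) :
    (forall e, 0 < e -> exists N, forall m n, (N <= m)%N -> (N <= n)%N ->
       nrm (u m - u n) < e) ->
  exists l, tends_to u l.
Proof.
move=> cu; have [e /gt0_complex [r r0 ->]|l hl] := @cstar_complete _ _ u.
  have [N hN] := cu r r0; exists N => m n hm hn.
  by rewrite cstar_normE ltcR; exact: hN.
exists l => e e0; have e0' : 0 < e%:C%C by rewrite ltcR.
by have [N hN] := hl _ e0'; exists N => n /hN; rewrite cstar_normE ltcR.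
Qed.

Lemma tends_to_unique u l l' : tends_to u l -> tends_to u l' -> l = l'.
Proof.
move=> h h'; apply/eqP; rewrite -subr_eq0; apply/eqP/nrm_le0 => e e0.
have e2 : 0 < e / 2 by rewrite divr_gt0.
have [N hN] := h _ e2; have [N' hN'] := h' _ e2.
have := hN _ (leq_maxl N N'); have := hN' _ (leq_maxr N N').
set v := u _ => h1 h2; have -> : l - l' = (v - l') - (v - l).
  by rewrite opprB [RHS]addrC addrA subrK.
by have := nrmB (v - l') (v - l); lra.
Qed.

Lemma tends_to_cst x : tends_to (fun=> x) x.
Proof. by move=> e e0; exists 0%N => n _; rewrite subrr nrm0. Qed.

Lemma tends_toS u l : tends_to u l -> tends_to (fun n => u n.+1) l.
Proof. by move=> h e /h[N hN]; exists N => n Nn; apply: hN; exact: leqW. Qed.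

Lemma tends_toD u v k l : tends_to u k -> tends_to v l ->
  tends_to (fun n => u n + v n) (k + l).
Proof.
move=> h h' e e0; have e2 : 0 < e / 2 by rewrite divr_gt0.
have [N hN] := h _ e2; have [N' hN'] := h' _ e2.
exists (maxn N N') => n; rewrite geq_max => /andP[/hN h1 /hN' h2].
rewrite opprD addrACA; have := nrmD (u n - k) (v n - l); lra.
Qed.

Lemma tends_toZ z u k : tends_to u k -> tends_to (fun n => z *: u n) (z *: k).
Proof.
move=> h e e0; have c0 : 0 < cabs z + 1 by rewrite ltr_wpDl // cabs_ge0.
have [N hN] := h (e / (cabs z + 1)) (divr_gt0 e0 c0); exists N => n /hN.
rewrite -scalerBr nrmZ ltr_pdivlMr // mulrC mulrDl mul1r.
have := nrm_ge0 (u n - k); lra.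
Qed.

Lemma tends_to_star u k : tends_to u k -> tends_to (fun n => star (u n)) (star k).
Proof. by move=> h e /h[N hN]; exists N => n /hN; rewrite -starB nrm_star. Qed.

Lemma tends_toM u v k l : tends_to u k -> tends_to v l ->
  tends_to (fun n => u n * v n) (k * l).
Proof.
move=> h h' e e0.
pose d := Num.min 1 (e / (nrm k + nrm l + 1)).
have c0 : 0 < nrm k + nrm l + 1 by rewrite ltr_wpDl // addr_ge0 // nrm_ge0.
have d0 : 0 < d by rewrite lt_min ltr01 divr_gt0.
have d1 : d <= 1 by rewrite ge_min lexx.
have de : d * (nrm k + nrm l + 1) <= e by rewrite -ler_pdivlMr // ge_min lexx orbT.
have [N hN] := h _ d0; have [N' hN'] := h' _ d0.
exists (maxn N N') => n; rewrite geq_max => /andP[/hN h1 /hN' h2].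
have -> : u n * v n - k * l = (u n - k) * (v n - l) + (u n - k) * l + k * (v n - l).
  by rewrite -mulrDr subrK mulrBl mulrBr addrA subrK.
have := nrmD ((u n - k) * (v n - l) + (u n - k) * l) (k * (v n - l)).
have := nrmD ((u n - k) * (v n - l)) ((u n - k) * l).
have := nrmM (u n - k) (v n - l); have := nrmM (u n - k) l; have := nrmM k (v n - l).
have := nrm_ge0 k; have := nrm_ge0 l; have := nrm_ge0 (u n - k); have := nrm_ge0 (v n - l).
nra.
Qed.

Lemma geometric_lt (r C e : R) : 0 <= r < 1 -> 0 < e ->
  exists N, forall n, (N <= n)%N -> C * r ^+ n < e.
Proof.
move=> /andP[r0 r1] e0; pose D := `|C| + 1.
have D0 : 0 < D by rewrite ltr_wpDl.
have /cvgr_lt /(_ _ (divr_gt0 e0 D0)) [N _ hN] : r ^+ n @[n --> \oo] --> 0.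
  by apply: cvg_expr; rewrite ger0_norm.
exists N => n /hN /=; rewrite ltr_pdivlMr // mulrC; apply: le_lt_trans.
by apply: ler_wpM2r; rewrite ?exprn_ge0 // /D (le_trans (ler_norm _)) // lerDl.
Qed.

(** Neumann series, square roots and the functional calculus converge by this
    criterion. *)
Lemma geometric_tends_to (u : nat -> A) (r C : R) : 0 <= r < 1 ->
    (forall n, nrm (u n.+1 - u n) <= C * r ^+ n) ->
  exists l, tends_to u l.
Proof.
move=> r01 ur; have /andP[r0 r1] := r01; have s0 : 0 < 1 - r by rewrite subr_gt0.
have C0 : 0 <= C.
  by have := le_trans (nrm_ge0 _) (ur 0%N); rewrite expr0 mulr1.
have urk n k : nrm (u (n + k)%N - u n) <= C / (1 - r) * r ^+ n * (1 - r ^+ k).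
  elim: k => [|k ih]; first by rewrite addn0 expr0 !subrr mulr0 nrm0.
  have := nrmD (u (n + k).+1 - u (n + k)%N) (u (n + k)%N - u n).
  rewrite addrA subrK -addnS => /le_trans; apply.
  have := ur (n + k)%N; rewrite addnS => h.
  have -> : C / (1 - r) * r ^+ n * (1 - r ^+ k.+1) =
    C * r ^+ (n + k) + C / (1 - r) * r ^+ n * (1 - r ^+ k).
    by rewrite exprD exprS; field; rewrite gt_eqF.
  exact: lerD.
apply: cauchy_tends_to => e e0.
have [N hN] := geometric_lt (C / (1 - r)) r01 e0; exists N.
suff W m n : (N <= m)%N -> (m <= n)%N -> nrm (u n - u m) < e.
  move=> m n hm hn; have [mn|/ltnW nm] := leqP m n; last exact: W.
  by rewrite nrm_distC; exact: W.
move=> hm /subnKC <-; apply: le_lt_trans (urk _ _) _.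
apply: le_lt_trans (hN _ hm).
rewrite -[X in _ <= X]mulr1 ler_wpM2l //.
  by rewrite !mulr_ge0 ?exprn_ge0 ?invr_ge0 // ltW.
by rewrite gerBl exprn_ge0.
Qed.

(** ** Inverses *)

Definition inverse x y := x * y = 1 /\ y * x = 1.

Lemma inverse_nrm_gt0 x y : inverse x y -> 0 < nrm y.
Proof.
move=> [h _]; rewrite nrm_gt0; apply/eqP => y0; move: h.
by rewrite y0 mulr0 => /esym/eqP; rewrite oner_eq0.
Qed.

(** The inverse is the sum of the powers of [x]. *)
Lemma neumann_inverse x : nrm x < 1 -> exists y, inverse (1 - x) y.
Proof.
move=> x1; have x01 : 0 <= nrm x < 1 by rewrite nrm_ge0.
have xn n : nrm (x ^+ n) <= 1 * nrm x ^+ n.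
  rewrite mul1r; elim: n => [|n ih]; first by rewrite !expr0 nrm1.
  by rewrite !exprS; exact: nrmM_le.
pose u n := \sum_(i < n) x ^+ i.
have [l ul] : exists l, tends_to u l.
  apply: (geometric_tends_to (C := 1) x01) => n.
  by rewrite /u big_ord_recr /= addrAC subrr add0r; exact: xn.
have x0 : tends_to (fun n => x ^+ n) 0.
  move=> e e0; have [N hN] := geometric_lt 1 x01 e0; exists N => n /hN.
  by rewrite subr0; exact: le_lt_trans (xn n).
have e1 : tends_to (fun n => 1 - x ^+ n) 1.
  have := tends_toD (tends_to_cst 1) (tends_toZ (-1) x0).
  rewrite scaler0 addr0; congr tends_to; apply/funext => n.
  by rewrite scaleN1r.
have un n : (1 - x) * u n = 1 - x ^+ n by rewrite -opprB mulNr -subrX1 opprB.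
have un' n : u n * (1 - x) = 1 - x ^+ n.
  rewrite -un; apply/esym/commr_sum => i _; apply: commrX; apply: commr_sym.
  by apply: commrB; [exact: commr1|].
exists l; split.
  apply: (tends_to_unique (tends_toM (tends_to_cst (1 - x)) ul)).
  by move: e1; congr tends_to; apply/funext => n; rewrite un.
apply: (tends_to_unique (tends_toM ul (tends_to_cst (1 - x)))).
by move: e1; congr tends_to; apply/funext => n; rewrite un'.
Qed.

(** The inverse of [d] is [y (1 - t)^-1] with [t = (x - d) y].  The bounds compare the
    values of a resolvent at neighbouring points. *)
Lemma perturbed_inverse x y d : inverse x y -> nrm (d - x) * nrm y <= 2^-1 ->
  exists y', [/\ inverse d y', nrm y' <= 2 * nrm y &
    nrm (y - y') <= 2 * nrm y ^+ 2 * nrm (d - x)].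
Proof.
move=> [xy yx] hd; have y0 : 0 < nrm y by exact: (inverse_nrm_gt0 (x := x)).
pose t := (x - d) * y.
have t2 : nrm t <= 2^-1 by apply: le_trans hd; rewrite nrm_distC; exact: nrmM.
have [v [tv vt]] : exists v, inverse (1 - t) v.
  by apply: neumann_inverse; lra.
have E : 1 - t = d * y by rewrite /t mulrBl xy opprB addrCA subrr addr0.
have dyv : d * (y * v) = 1 by rewrite mulrA -E.
have yvd : y * v * d = 1.
  have : v * (d * y) * x = x by rewrite -E vt mul1r.
  by rewrite -!mulrA yx mulr1 => ->.
have v2 : nrm v <= 2.
  have := nrmD 1 (t * v); have := nrmM_le t2 (lexx (nrm v)); rewrite nrm1.
  have e : 1 + t * v = v by rewrite -[X in X + _]tv mulrBl mul1r subrK.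
  by rewrite e; lra.
have yv : nrm (y * v) <= 2 * nrm y by rewrite mulrC; exact: nrmM_le.
exists (y * v); split=> //.
have -> : y - y * v = y * (d - x) * (y * v).
  by rewrite -mulrA mulrBl dyv mulrA xy mul1r mulrBr mulr1.
have -> : 2 * nrm y ^+ 2 * nrm (d - x) = nrm y * nrm (d - x) * (2 * nrm y) by ring.
by apply: nrmM_le => //; exact: nrmM_le.
Qed.

End CStarBasics.

(** * The norm of a self-adjoint element lies in its spectrum, up to a phase *)

Section SpectralRadius.
Context (R : realType) (A : cstarType R).
Implicit Types (x y v : A) (z : R[i]).

Lemma inverseZ z x y : z != 0 -> inverse x y -> inverse (z *: x) (z^-1 *: y).
Proof.
move=> z0 [xy yx]; split; rewrite -scalerAl -scalerAr scalerA ?xy ?yx.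
  by rewrite mulfV // scale1r.
by rewrite mulVf // scale1r.
Qed.

Lemma unit_circle_angle z : cabs z = 1 ->
  exists2 t, t \in `[- pi, pi] & z = cexp (t *i)%C.
Proof.
case: z => x y; rewrite /cabs normc_def /= => h.
have h2 : x ^+ 2 + y ^+ 2 = 1.
  by rewrite -[LHS]sqr_sqrtr ?addr_ge0 ?sqr_ge0 // h expr1n.
have x1 : -1 <= x <= 1 by have := sqr_ge0 y; nra.
have [/andP[a0 api] ax] := acos_def x1.
have sx : sin (acos x) = `|y|.
  by rewrite sin_acos // -h2 addrAC subrr add0r sqrtr_sqr.
have ce s : cexp (s *i)%C = (cos s +i* sin s)%C :> R[i].
  rewrite /cexp /= expR0.
  by apply/eqP; rewrite eq_complex /=; apply/andP; split; apply/eqP; ring.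
have [y0|y0] := leP 0 y.
  exists (acos x); first by rewrite in_itv /= api andbT; lra.
  by rewrite ce ax sx ger0_norm.
exists (- acos x); first by rewrite in_itv /=; lra.
by rewrite ce cosN sinN ax sx ltr0_norm // opprK.
Qed.

Lemma cexp_imaginary_lipschitz (s t : R) : `|s - t| <= 1 ->
  cabs (cexp (s *i)%C - cexp (t *i)%C) <= 2 * expR 1 * `|s - t|.
Proof.
move=> st1.
have -> : cexp (s *i)%C - cexp (t *i)%C =
    cexp (t *i)%C * (cexp ((s - t) *i)%C - 1) :> R[i].
  rewrite mulrBr mulr1 -cexpD; congr (cexp _ - _).
  by apply/eqP; rewrite eq_complex /= addr0 addrC subrK !eqxx.
rewrite cabsM cabs_cexp /= expR0 mul1r; apply: le_trans (cexp_lipschitz _) _.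
have -> : cabs ((s - t) *i)%C = `|s - t|.
  by rewrite /cabs normc_def /= expr0n add0r sqrtr_sqr.
have := normr_ge0 (s - t); have : expR `|s - t| <= expR 1 by rewrite ler_expR.
nra.
Qed.

(** By [perturbed_inverse] the resolvent is bounded near each point of the circle,
    hence on the circle by compactness. *)
Lemma resolvent_bounded y :
    (forall z, cabs z = 1 -> exists r, inverse (1 - z *: y) r) ->
  exists2 M, 0 < M & forall z, cabs z = 1 ->
    exists2 r, inverse (1 - z *: y) r & nrm r <= M.
Proof.
move=> hy.
pose P (B t : R) := exists2 r, inverse (1 - cexp (t *i)%C *: y) r & nrm r <= B.
have /compact_near_coveringP /(_ R (pinfty_nbhs R) P) := @segment_compact R (- pi) pi.
have nf : Filter (pinfty_nbhs R) by exact: _.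
move=> /(_ nf) [t _|M [Mr hM]].
  have [|r hr] := hy (cexp (t *i)%C); first by rewrite cabs_cexp /= expR0.
  have r0 := inverse_nrm_gt0 hr.
  pose c := 4 * expR 1 * (nrm y + 1) * nrm r.
  have c0 : 0 < c by rewrite !mulr_gt0 ?expR_gt0 // ltr_wpDl // nrm_ge0.
  pose d := Num.min 1 c^-1.
  have d0 : 0 < d by rewrite lt_min ltr01 invr_gt0.
  exists (ball t d, [set B | 2 * nrm r < B]).
    split; first exact: nbhsx_ballx.
    by exists (2 * nrm r); split => //; exact: num_real.
  move=> [s B] [/= ts rB].
  have {}ts : `|s - t| < d by rewrite distrC.
  have st1 : `|s - t| <= 1 by rewrite (le_trans (ltW ts)) // ge_min lexx.
  have stc : `|s - t| * c <= 1.
    by rewrite -ler_pdivlMr // mul1r (le_trans (ltW ts)) // ge_min lexx orbT.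
  have [|r' [hr' r'r _]] := perturbed_inverse (d := 1 - cexp (s *i)%C *: y) hr.
    rewrite opprB addrC addrA subrK -scalerBl nrmZ cabs_distC.
    have := cexp_imaginary_lipschitz st1; move: stc; rewrite /c.
    set e := cabs _; have := nrm_ge0 y; have := expR_gt0 (1 : R).
    have : 0 <= e by exact: cabs_ge0.
    set D := `|s - t|; have : 0 <= D by exact: normr_ge0.
    move=> D0 e0 E0 y0 h1 h2.
    have : e * nrm y * nrm r <= 2 * expR 1 * D * nrm y * nrm r.
      by rewrite !ler_wpM2r // ltW.
    have : 0 <= D * expR 1 * nrm r by rewrite !mulr_ge0 // ltW.
    lra.
  by exists r' => //; exact: le_trans r'r (ltW rB).
pose B := Num.max M 0 + 1.
have MB : M < B by rewrite /B ltr_pwDr // le_max lexx.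
exists B; first by rewrite /B ltr_wpDl // le_max lexx orbT.
move=> z /unit_circle_angle[t ht ->]; exact: (hM _ MB).
Qed.

(** One halving: [x] and [- x] are the two square roots of [x^2]. *)
Lemma inverse_half_sum x y1 y2 : inverse (1 - x) y1 -> inverse (1 + x) y2 ->
  inverse (1 - x * x) (2^-1 *: (y1 + y2)).
Proof.
have e1 : 1 - x * x = (1 - x) * (1 + x) by rewrite mulrDr mulr1 mulrBl mul1r addrA subrK.
have e2 : 1 - x * x = (1 + x) * (1 - x) by rewrite mulrBr mulr1 mulrDl mul1r opprD addrA addrK.
have two : 2^-1 *: ((1 + x) + (1 - x)) = 1 :> A.
  rewrite addrACA subrr addr0 scalerDr -scalerDl.
  have -> : 2^-1 + 2^-1 = 1 :> R[i] by field.
  by rewrite scale1r.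
move=> [h1 h1'] [h2 h2']; split.
  rewrite -scalerAr mulrDr {1}e2 e1 -!mulrA h1 h2 !mulr1; exact: two.
rewrite -scalerAl mulrDl {1}e1 e2 !mulrA h1' h2' !mul1r; exact: two.
Qed.

(** Suppose that [x] has norm [1] and that [1 - z x] is invertible on the whole
    circle [|z| = 1], with inverses bounded by [M].  The mean of [1 / (1 - z x)] over
    the [n]-th roots [z] of a number [w] of modulus [1] is [1 / (1 - w x^n)], and for
    [n = 2^k] it is reached by [k] halvings.  Compare it with
    [1 / (1 - w t^n x^n)], where [t < 1] is close to [1]: the two differ by at most
    [2 M^2 (1 - t)], and the second one tends to [1] as [n] grows.  So
    [1 / (1 - x^n)] gets close to [1] and the norm of [x^n] drops below [1]; but this
    norm is [1] when [x] is self-adjoint and [n] is a power of [2]. *)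
Lemma selfadjoint_circle_spectrum x : star x = x -> 0 < nrm x ->
  exists2 z, cabs z = nrm x & ~ cstar_invertible (x - z%:A).
Proof.
move=> xs s0; set s := nrm x in s0 *; apply: contrapT => hn.
have inv z : cabs z = s -> exists r, inverse (x - z%:A) r.
  by move=> hz; apply: contrapT => h; apply: hn; exists z => // -[r hr]; apply: h; exists r.
pose y := s^-1%:C%C *: x.
have ys : star y = y.
  rewrite /y starZ xs; congr (_ *: _); by apply/eqP; rewrite eq_complex /= oppr0 !eqxx.
have y1 : nrm y = 1.
  by rewrite nrmZ cabs_real gtr0_norm ?invr_gt0 // mulVf // gt_eqF.
have sC : s%:C%C != 0 :> R[i] by rewrite -cabs_gt0 cabs_real gtr0_norm.
have [|M M0 hM] := @resolvent_bounded y.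
  move=> z z1; have z0 : z != 0 by rewrite -cabs_gt0 z1.
  have [|r hr] := inv (s%:C%C / z).
    by rewrite cabsM cabsV z1 invr1 mulr1 cabs_real gtr0_norm.
  have c0 : - (z / s%:C%C) != 0 by rewrite oppr_eq0 mulf_neq0 // invr_eq0.
  have := inverseZ c0 hr; set r' := _^-1 *: r => hr'; exists r'.
  move: hr'; congr inverse; rewrite scalerBr scaleNr scalerA mulNr scaleNr opprK.
  have -> : z / s%:C%C * (s%:C%C / z) = 1 by field; rewrite z0 sC.
  by rewrite scale1r addrC /y scalerA fmorphV.
(* d = 1 - t; the second bound makes 1 - z t y a perturbation of 1 - z y, the third
   one makes their inverses differ by at most 1/8. *)
pose d := Num.min (2^-1) (Num.min (2 * M)^-1 (16 * M ^+ 2)^-1).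
have M2 : 0 < 16 * M ^+ 2 by rewrite mulr_gt0 // exprn_gt0.
have d0 : 0 < d by rewrite !lt_min !invr_gt0 M2 andbT ltr0n /= mulr_gt0.
have d2 : d <= 2^-1 by rewrite ge_min lexx.
have dM : d * (2 * M) <= 1.
  by rewrite -ler_pdivlMr ?mulr_gt0 // mul1r !ge_min lexx orbT.
have dM2 : d * (16 * M ^+ 2) <= 1.
  by rewrite -ler_pdivlMr // mul1r !ge_min lexx !orbT.
pose t := 1 - d.
have t01 : 0 <= t < 1 by rewrite /t; lra.
have claim k z : cabs z = 1 -> exists g h,
    [/\ inverse (1 - z *: y ^+ (2 ^ k)) g,
        inverse (1 - (z * t%:C%C ^+ (2 ^ k)) *: y ^+ (2 ^ k)) h,
        nrm h <= 2 * M & nrm (g - h) <= 8^-1].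
  elim: k z => [|k ih] z z1.
    have [r hr rM] := hM z z1; rewrite expn0 !expr1.
    have e : nrm (1 - (z * t%:C%C) *: y - (1 - z *: y)) = d.
      rewrite opprB addrC addrA subrK -scalerBl nrmZ y1 mulr1.
      have -> : z - z * t%:C%C = z * d%:C%C.
        by rewrite /t rmorphB rmorph1; ring.
      by rewrite cabsM z1 mul1r cabs_real gtr0_norm.
    have r0 := nrm_ge0 r.
    have [|r' [hr' r'1 r'2]] := perturbed_inverse (d := 1 - (z * t%:C%C) *: y) hr.
      by rewrite e; nra.
    exists r, r'; split=> //; first by lra.
    apply: le_trans r'2 _; rewrite e.
    have : nrm r ^+ 2 <= M ^+ 2 by rewrite lerXn2r ?nnegrE // ltW.
    nra.
  have w2 := sqr_sqrtc z; set w := sqrtc z in w2.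
  have w1 : cabs w = 1.
    have : cabs w ^+ 2 = 1 by rewrite -cabsX w2.
    by move/eqP; rewrite sqrf_eq1 => /orP[/eqP //|/eqP h]; have := cabs_ge0 w; rewrite h; lra.
  have [g1 [h1 [hg1 hh1 h1M gh1]]] := ih w w1.
  have [|g2 [h2 [hg2 hh2 h2M gh2]]] := ih (- w); first by rewrite cabsN.
  exists (2^-1 *: (g1 + g2)), (2^-1 *: (h1 + h2)).
  have c2 : cabs (2^-1 : R[i]) = 2^-1.
    by rewrite cabsV -[2]/(2%:R) -(rmorph_nat (real_complex R)) cabs_real ger0_norm.
  split.
  - rewrite scaleNr opprK in hg2; have := inverse_half_sum hg1 hg2.
    by rewrite -scalerAl -scalerAr scalerA -expr2 w2 -expr2 -exprM -expnSr.
  - rewrite mulNr scaleNr opprK in hh2; have := inverse_half_sum hh1 hh2.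
    rewrite -scalerAl -scalerAr scalerA -expr2 exprMn w2 -expr2 -!exprM -expnSr.
    by [].
  - rewrite nrmZ c2; have := nrmD h1 h2; lra.
  - rewrite -scalerBr nrmZ c2 opprD addrACA; have := nrmD (g1 - h1) (g2 - h2); lra.
have y2 k : star (y ^+ (2 ^ k)) = y ^+ (2 ^ k) /\ nrm (y ^+ (2 ^ k)) = 1.
  elim: k => [|k [ih1 ih2]]; first by rewrite expn0 expr1.
  rewrite expnSr exprM expr2 starM ih1; split=> //.
  by rewrite -{1}ih1 nrm_cstar ih2 expr1n.
have [N hN] := geometric_lt (16 * M) t01 ltr01.
have [g [h []]] := claim N 1 (cabs1 R).
have [_] := y2 N; set v := y ^+ _; rewrite mul1r scale1r => v1 [vg _] [vh _] hM' gh.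
have tN : t ^+ (2 ^ N) * (2 * M) <= 8^-1.
  by have := hN _ (ltnW (ltn_expl N (ltnSn 1))); lra.
have t0 : 0 <= t ^+ (2 ^ N) by rewrite exprn_ge0 //; case/andP: t01.
have h1 : nrm (h - 1) <= 8^-1.
  have -> : h - 1 = (t%:C%C ^+ (2 ^ N)) *: v * h.
    by rewrite -[X in _ - X]vh mulrBl mul1r opprB addrC subrK.
  apply: le_trans tN; apply: nrmM_le => //.
  by rewrite nrmZ v1 mulr1 cabsX cabs_real ger0_norm ?expr0n //; case/andP: t01.
have g1 : nrm (g - 1) <= 4^-1.
  have -> : g - 1 = (g - h) + (h - 1) by rewrite addrA subrK.
  have := nrmD (g - h) (h - 1); lra.
have vg1 : v * g = g - 1 by rewrite -[X in _ - X]vg mulrBl mul1r opprB addrC subrK.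
have : nrm v <= 4^-1 + 1 * 4^-1.
  have -> : v = v * g - v * (g - 1) by rewrite mulrBr mulr1 opprB addrC subrK.
  apply: le_trans (nrmB _ _) _; apply: lerD; first by rewrite vg1.
  by apply: nrmM_le; rewrite ?v1.
rewrite v1; lra.
Qed.

End SpectralRadius.

(** * The continuous functional calculus of a self-adjoint element *)

Section FunctionalCalculus.
Context (R : realType) (A : cstarType R).
Implicit Types (a b c x y : A) (z l : R[i]) (p q : {poly R[i]}) (f g : R[i] -> R[i]).

Lemma cstar_invertibleM x y :
  cstar_invertible x -> cstar_invertible y -> cstar_invertible (x * y).
Proof.
move=> [x' [h1 h2]] [y' [h3 h4]]; exists (y' * x'); split.
  by rewrite mulrA -(mulrA x) h3 mulr1.
by rewrite mulrA -(mulrA y') h2 mulr1.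
Qed.

Lemma cstar_invertibleZ z x :
  z != 0 -> cstar_invertible x -> cstar_invertible (z *: x).
Proof. by move=> z0 [y xy]; exists (z^-1 *: y); exact: inverseZ. Qed.

(** The half of the spectral mapping theorem that rests on the factorization of
    complex polynomials. *)
Lemma horner_invertible x p : p != 0 ->
  (forall l, cstar_spectrum x l -> p.[l] != 0) -> cstar_invertible (horner_alg x p).
Proof.
move=> p0 hp; have [r ep] := closed_field_poly_normal p.
rewrite ep linearZ /= mulr_algl; apply: cstar_invertibleZ; first by rewrite lead_coef_eq0.
have : {in r, forall l, cstar_invertible (x - l%:A)}.
  move=> l lr; apply: contrapT => /hp /negP; apply; rewrite ep hornerZ mulf_eq0.
  by apply/orP; right; rewrite -[_ == 0]/(root _ _) root_prod_XsubC.
elim: r {ep} => [|l r ih] hr.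
  by rewrite big_nil rmorph1; exists 1; rewrite mulr1.
rewrite big_cons rmorphM; apply: cstar_invertibleM.
  by rewrite rmorphB /= horner_algX horner_algC; apply: hr; rewrite mem_head.
by apply: ih => t tr; apply: hr; rewrite in_cons tr orbT.
Qed.

Section SelfAdjoint.
Context (a : A) (a_star : star a = a).
Context (spec_real : forall l, cstar_spectrum a l -> l = (complex.Re l)%:C%C).

Lemma star_horner p : star (horner_alg a p) = horner_alg a (map_poly Num.conj p).
Proof.
elim/poly_ind: p => [|p c ih]; first by rewrite !rmorph0 star0.
rewrite !rmorphD !rmorphM /= map_polyX map_polyC /= !horner_algX !horner_algC.
rewrite starD starM ih a_star starZ star1; congr (_ + _).
by rewrite -[X in X * _](horner_algX a) -rmorphM mulrC rmorphM /= horner_algX.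
Qed.

Lemma spectrum_nonempty : exists l, cstar_spectrum a l.
Proof.
have [/nrm_eq0 a0|a0] := eqVneq (nrm a) 0.
  exists 0 => -[b [h _]]; move: h; rewrite a0 scale0r subrr mul0r => /esym/eqP.
  by rewrite oner_eq0.
have [|l _ hl] := selfadjoint_circle_spectrum a_star; last by exists l.
by rewrite lt_def a0 nrm_ge0.
Qed.

(** The C*-identity replaces [p] by [q = p^* p], for which [q(a)] is self-adjoint;
    its norm is then the modulus of a point of its spectrum, that is of a value of
    [q] on the spectrum of [a]. *)
Lemma nrm_horner_le p (k : R) : 0 <= k ->
  (forall l, cstar_spectrum a l -> cabs p.[l] <= k) -> nrm (horner_alg a p) <= k.
Proof.
move=> k0 hp; set b := horner_alg a p; rewrite leNgt; apply/negP => kb.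
pose q := map_poly Num.conj p * p.
have eb : star b * b = horner_alg a q by rewrite /b star_horner rmorphM.
have qk l : cstar_spectrum a l -> cabs q.[l] <= k ^+ 2.
  move=> hl; rewrite hornerM cabsM expr2; have lR := spec_real hl.
  have -> : (map_poly Num.conj p).[l] = p.[l]^*.
    by rewrite -horner_map /=; congr (_.[_]); rewrite lR conjC_realE.
  by rewrite cabs_conj; apply: ler_pM; rewrite ?cabs_ge0 ?hp.
have bb : star (star b * b) = star b * b by rewrite starM starK.
have [|z zb] := selfadjoint_circle_spectrum bb.
  by rewrite nrm_cstar exprn_gt0 // (le_lt_trans k0).
have zk : k ^+ 2 < cabs z by rewrite zb nrm_cstar ltrXn2r ?nnegrE ?nrm_ge0.
have qz l : cstar_spectrum a l -> (q - z%:P).[l] != 0.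
  move=> hl; rewrite hornerD hornerN hornerC subr_eq0; apply/eqP => e.
  by have := qk _ hl; rewrite e leNgt zk.
apply; rewrite eb -(horner_algC a) -rmorphB; apply: horner_invertible => //.
have [l hl] := spectrum_nonempty; apply/eqP => e.
by have := qz l hl; rewrite e horner0 eqxx.
Qed.

Lemma fcalcP f b : cstar_fcalc f a b <-> forall e : R, 0 < e -> exists p,
  (forall l, cstar_spectrum a l -> cabs (p.[l] - f l) < e) /\
  nrm (horner_alg a p - b) < e.
Proof.
split=> h e.
  move=> e0; have [|p [h1 h2]] := h e%:C%C; first by rewrite ltcR.
  by exists p; split=> [l /h1|]; [rewrite cabs_lt|rewrite -ltcR -cstar_normE].
move=> /gt0_complex[r r0 ->]; have [p [h1 h2]] := h r r0.
by exists p; split=> [l /h1|]; [rewrite cabs_lt|rewrite cstar_normE ltcR].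
Qed.

(** Contractivity makes the functional calculus single-valued, and transfers scalar
    estimates on the spectrum to the algebra. *)
Lemma fcalc_le f b (k : R) : cstar_fcalc f a b ->
  (forall l, cstar_spectrum a l -> cabs (f l) <= k) -> nrm b <= k.
Proof.
move=> /fcalcP h hk.
have k0 : 0 <= k.
  by have [l hl] := spectrum_nonempty; exact: le_trans (cabs_ge0 _) (hk l hl).
apply/ler_addgt0Pr => e e0; have e2 : 0 < e / 2 by rewrite divr_gt0.
have [p [h1 h2]] := h _ e2.
have : nrm (horner_alg a p) <= k + e / 2.
  apply: nrm_horner_le => [|l hl]; first by rewrite addr_ge0 // ltW.
  have := cabsD (p.[l] - f l) (f l); rewrite subrK.
  by have := h1 l hl; have := hk l hl; lra.
have := nrmB (horner_alg a p) (horner_alg a p - b); rewrite opprB addrC subrK; lra.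
Qed.

Lemma eq_fcalc f g b : (forall l, cstar_spectrum a l -> f l = g l) ->
  cstar_fcalc f a b -> cstar_fcalc g a b.
Proof.
by move=> fg h e /h[p [h1 h2]]; exists p; split=> // l hl; rewrite -fg ?h1.
Qed.

Lemma fcalc_poly p : cstar_fcalc (fun l => p.[l]) a (horner_alg a p).
Proof.
apply/fcalcP => e e0; exists p.
by split=> [l _|]; rewrite subrr ?cabs0 ?nrm0.
Qed.

Lemma fcalc_cst z : cstar_fcalc (fun=> z) a z%:A.
Proof.
rewrite -(horner_algC a); apply: eq_fcalc (fcalc_poly z%:P) => l _.
by rewrite hornerC.
Qed.

Lemma fcalcD f g b c : cstar_fcalc f a b -> cstar_fcalc g a c ->
  cstar_fcalc (fun l => f l + g l) a (b + c).
Proof.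
move=> /fcalcP hf /fcalcP hg; apply/fcalcP => e e0.
have e2 : 0 < e / 2 by rewrite divr_gt0.
have [p [p1 p2]] := hf _ e2; have [q [q1 q2]] := hg _ e2; exists (p + q).
split=> [l hl|].
  rewrite hornerD opprD addrACA; have := cabsD (p.[l] - f l) (q.[l] - g l).
  by have := p1 l hl; have := q1 l hl; lra.
rewrite rmorphD opprD addrACA /=.
have := nrmD (horner_alg a p - b) (horner_alg a q - c); lra.
Qed.

Lemma fcalcM f g b c (k : R) :
    (forall l, cstar_spectrum a l -> cabs (f l) <= k) ->
    (forall l, cstar_spectrum a l -> cabs (g l) <= k) ->
    cstar_fcalc f a b -> cstar_fcalc g a c ->
  cstar_fcalc (fun l => f l * g l) a (b * c).
Proof.
move=> fk gk hf hg.
have bk := fcalc_le hf fk; have ck := fcalc_le hg gk.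
move: hf hg => /fcalcP hf /fcalcP hg; apply/fcalcP => e e0.
have k0 : 0 <= k := le_trans (nrm_ge0 _) bk.
pose K := 2 * k + 1; have K0 : 0 < K by rewrite /K; lra.
pose d := Num.min 1 (e / (2 * K)).
have d0 : 0 < d by rewrite lt_min ltr01 divr_gt0 // mulr_gt0.
have d1 : d <= 1 by rewrite ge_min lexx.
have de : d * K < e.
  have : d * (2 * K) <= e by rewrite -ler_pdivlMr ?mulr_gt0 // ge_min lexx orbT.
  have : 0 < d * K by rewrite mulr_gt0.
  lra.
have small (s t u v : R) : 0 <= s <= d -> 0 <= t <= d -> 0 <= u <= k -> 0 <= v <= k ->
  s * t + s * v + u * t < e by rewrite /K in de; nra.
have [p [p1 p2]] := hf _ d0; have [q [q1 q2]] := hg _ d0; exists (p * q).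
split=> [l hl|].
  have -> : (p * q).[l] - f l * g l = (p.[l] - f l) * (q.[l] - g l) +
    (p.[l] - f l) * g l + f l * (q.[l] - g l) by rewrite hornerM; ring.
  apply: le_lt_trans (cabsD _ _) _.
  apply: le_lt_trans (lerD (cabsD _ _) (lexx _)) _; rewrite !cabsM.
  by apply: small; rewrite ?cabs_ge0 ?(ltW (p1 _ hl)) ?(ltW (q1 _ hl)) ?fk ?gk.
rewrite rmorphM /=; set P := horner_alg a p in p2 *; set Q := horner_alg a q in q2 *.
have -> : P * Q - b * c = (P - b) * (Q - c) + (P - b) * c + b * (Q - c).
  by rewrite -mulrDr subrK mulrBl mulrBr addrA subrK.
apply: le_lt_trans (nrmD _ _) _.
apply: le_lt_trans (lerD (nrmD _ _) (lexx _)) _.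
apply: le_lt_trans (lerD (lerD (nrmM _ _) (nrmM _ _)) (nrmM _ _)) _.
by apply: small; rewrite ?nrm_ge0 ?(ltW p2) ?(ltW q2) ?bk ?ck.
Qed.

Lemma fcalcZ z f b : cstar_fcalc f a b -> cstar_fcalc (fun l => z * f l) a (z *: b).
Proof.
move=> /fcalcP hf; apply/fcalcP => e e0.
have c0 : 0 < cabs z + 1 by rewrite ltr_wpDl // cabs_ge0.
have [p [p1 p2]] := hf (e / (cabs z + 1)) (divr_gt0 e0 c0); exists (z *: p).
have small (s : R) : 0 <= s -> s < e / (cabs z + 1) -> cabs z * s < e.
  by move=> s0; rewrite ltr_pdivlMr //; lra.
split=> [l hl|]; first by rewrite hornerZ -mulrBr cabsM small ?cabs_ge0 ?p1.
by rewrite linearZ /= mulr_algl -scalerBr nrmZ small ?nrm_ge0.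
Qed.

Lemma fcalc_star f b : cstar_fcalc f a b -> cstar_fcalc (fun l => (f l)^*) a (star b).
Proof.
move=> /fcalcP hf; apply/fcalcP => e /hf[p [p1 p2]].
exists (map_poly Num.conj p); split=> [l hl|].
  have -> : (map_poly Num.conj p).[l] = p.[l]^*.
    by rewrite -horner_map /=; congr (_.[_]); rewrite (spec_real hl) conjC_realE.
  by rewrite -rmorphB /= cabs_conj p1.
by rewrite -star_horner -starB nrm_star.
Qed.

Lemma fcalcB f g b c : cstar_fcalc f a b -> cstar_fcalc g a c ->
  cstar_fcalc (fun l => f l - g l) a (b - c).
Proof.
move=> hf hg; have := fcalcD hf (fcalcZ (-1) hg).
by rewrite scaleN1r; apply: eq_fcalc => l _; rewrite mulN1r.
Qed.

Lemma fcalc_unique f b c : cstar_fcalc f a b -> cstar_fcalc f a c -> b = c.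
Proof.
move=> hb hc; apply/eqP; rewrite -subr_eq0; apply/eqP/nrm_eq0/eqP.
rewrite eq_le nrm_ge0 andbT; apply: (fcalc_le (fcalcB hb hc)) => l _.
by rewrite subrr cabs0.
Qed.

Lemma fcalc_comm f b x : cstar_fcalc f a b -> x * a = a * x -> x * b = b * x.
Proof.
move=> /fcalcP h xa; apply/eqP; rewrite -subr_eq0; apply/eqP/nrm_le0 => e e0.
have c0 : 0 < 2 * nrm x + 1 by rewrite ltr_wpDl // mulr_ge0 // nrm_ge0.
have [p [_ hp]] := h _ (divr_gt0 e0 c0).
have xp : x * horner_alg a p = horner_alg a p * x.
  elim/poly_ind: p {hp} => [|p c ih]; first by rewrite rmorph0 mulr0 mul0r.
  rewrite rmorphD rmorphM /= horner_algX horner_algC mulrDr mulrDl mulrA ih.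
  by rewrite -!mulrA xa mulr_algl mulr_algr.
move: hp; set P := horner_alg a p in xp *; rewrite ltr_pdivlMr // => hp.
have -> : x * b - b * x = (P - b) * x - x * (P - b).
  by rewrite mulrBl mulrBr xp opprB [RHS]addrC addrA subrK.
apply: le_trans (nrmB _ _) _; have := nrmM (P - b) x; have := nrmM x (P - b).
have := nrm_ge0 (P - b); lra.
Qed.

Lemma fcalc_exists f :
    (forall e : R, 0 < e -> exists p,
       forall l, cstar_spectrum a l -> cabs (p.[l] - f l) < e) ->
  exists b, cstar_fcalc f a b.
Proof.
move=> hf; have half0 n : 0 < (2^-1 : R) ^+ n by rewrite exprn_gt0 // invr_gt0.
have [p hp] := choice (fun n => hf _ (half0 n)).
have [||b hb] := @geometric_tends_to _ A (fun n => horner_alg a (p n)) (2^-1) 2.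
- by lra.
- move=> n; rewrite -rmorphB; apply: nrm_horner_le => [|l hl].
    by rewrite mulr_ge0 // ltW.
  rewrite hornerD hornerN.
  have -> : (p n.+1).[l] - (p n).[l] = ((p n.+1).[l] - f l) - ((p n).[l] - f l) by ring.
  have := cabsB ((p n.+1).[l] - f l) ((p n).[l] - f l).
  have := hp n.+1 l hl; have := hp n l hl; have := half0 n; rewrite exprS; lra.
exists b; apply/fcalcP => e e0.
have h01 : 0 <= (2^-1 : R) < 1 by lra.
have [N hN] := geometric_lt 1 h01 e0; have [N' hN'] := hb e e0.
exists (p (maxn N N')); split=> [l hl|]; last exact: hN' (leq_maxr _ _).
by apply: lt_trans (hp _ l hl) _; have := hN _ (leq_maxl N N'); rewrite mul1r.
Qed.

End SelfAdjoint.

(** ** Powers of a positive invertible element *)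

Lemma spectrum_le x l : cstar_spectrum x l -> cabs l <= nrm x.
Proof.
move=> hl; rewrite leNgt; apply/negP => xl; apply: hl.
have l0 : l != 0 by rewrite -cabs_gt0 (le_lt_trans (nrm_ge0 x)).
have [|y hy] := @neumann_inverse _ _ (l^-1 *: x).
  by rewrite nrmZ cabsV mulrC ltr_pdivrMr ?cabs_gt0 // mul1r.
have := cstar_invertibleZ (z := - l) _ (ex_intro _ y hy).
rewrite oppr_eq0 => /(_ l0); congr cstar_invertible.
by rewrite scalerBr scaleNr scaleNr opprK scalerA mulfV // scale1r addrC.
Qed.

Lemma spectrum_ge x y l : inverse x y -> cstar_spectrum x l -> (2 * nrm y)^-1 <= cabs l.
Proof.
move=> xy hl; rewrite leNgt; apply/negP => ly; apply: hl.
have y0 := inverse_nrm_gt0 xy.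
have [|y' [h _ _]] := perturbed_inverse (d := x - l%:A) xy; last by exists y'.
rewrite addrAC subrr add0r nrmN nrmZ nrm1 mulr1.
move: ly; rewrite -[(_ * _)^-1]mul1r ltr_pdivlMr ?mulr_gt0 //; lra.
Qed.

Lemma positive_invertible_spectrum a : cstar_positive a -> cstar_invertible a ->
  exists m M : R, [/\ 0 < m, m < M & forall l, cstar_spectrum a l ->
    exists2 t : R, m <= t <= M & l = t%:C%C].
Proof.
move=> [_ pa] [b hb]; have b0 : 0 < nrm b by exact: (inverse_nrm_gt0 hb).
have m0 : 0 < (2 * nrm b)^-1 by rewrite invr_gt0 mulr_gt0.
exists (2 * nrm b)^-1, (nrm a + (2 * nrm b)^-1 + 1); split=> // [|l hl].
  by have := nrm_ge0 a; lra.
have [t t0 et] := ge0_complex (pa l hl); exists t => //.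
have := spectrum_ge hb hl; have := spectrum_le hl.
by rewrite et cabs_real ger0_norm //; lra.
Qed.

(** The spectrum lies in a segment [[m, M]] with [0 < m], on which [ln] and [t |-> t^z]
    are Lipschitz, hence limits of polynomials.  Each property of the powers is then
    the image of a scalar one. *)
Theorem cstar_complex_powers a : cstar_positive a -> cstar_invertible a ->
  complex_powers (@star R A) (@nrm R A) (cstar_pow a) /\ cstar_pow a 1 = a.
Proof.
move=> pa ia; have [m [M [m0 mM hs]]] := positive_invertible_spectrum pa ia.
have as_ := pa.1.
have sr l : cstar_spectrum a l -> l = (complex.Re l)%:C%C.
  by move=> /hs[t _ ->].
have fex f L : (forall s t, m <= s <= M -> m <= t <= M ->
    cabs (f s%:C%C - f t%:C%C) <= L * `|s - t|) -> exists b, cstar_fcalc f a b.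
  move=> fL; apply: (fcalc_exists as_ sr) => e e0.
  have [p hp] := lipschitz_poly_approx (f := fun t => f t%:C%C) mM fL e0.
  by exists p => l /hs[t ht ->]; exact: hp.
have pw z : cstar_fcalc (powfun z) a (cstar_pow a z).
  have [K hK] := powfun_lipschitz z M m0.
  by rewrite /cstar_pow; apply: xgetPex; exact: fex hK.
pose lnC (t : R[i]) : R[i] := (ln (complex.Re t))%:C%C.
have [L hL] : exists L, cstar_fcalc lnC a L.
  apply: (fex _ m^-1) => s t /andP[s1 _] /andP[t1 _].
  by rewrite /lnC /= -rmorphB cabs_real mulrC ln_lipschitz.
pose k := (M - m) / m + `|ln m|.
have lnk l : cstar_spectrum a l -> `|ln (complex.Re l)| <= k.
  move=> /hs[t /andP[t1 t2] ->] /=.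
  have := ln_lipschitz m0 t1 (lexx m); have := ler_normD (ln t - ln m) (ln m).
  rewrite subrK (ger0_norm (x := t - m)) ?subr_ge0 // /k.
  have : (t - m) / m <= (M - m) / m by rewrite ler_wpM2r ?invr_ge0 ?(ltW m0) //; lra.
  lra.
have lnCk l : cstar_spectrum a l -> cabs (lnC l) <= k.
  by move=> /lnk; rewrite /lnC cabs_real.
have pwb z l : cstar_spectrum a l -> cabs (powfun z l) <= expR (`|complex.Re z| * k).
  move=> /lnk h; rewrite cabs_powfun ler_expR; apply: le_trans (ler_norm _) _.
  by rewrite normrM ler_wpM2l.
have uniq := fcalc_unique as_ sr.
have a1 : cstar_pow a 1 = a.
  apply: uniq (pw 1) _; have := fcalc_poly a 'X; rewrite horner_algX.
  apply: eq_fcalc => l /hs[t /andP[t1 _] ->]; rewrite hornerX powfun1 //.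
  exact: lt_le_trans t1.
split=> //; split.
- move=> z w; apply: uniq (pw _) _.
  pose K := Num.max (expR (`|complex.Re z| * k)) (expR (`|complex.Re w| * k)).
  have zK l : cstar_spectrum a l -> cabs (powfun z l) <= K.
    by move=> /(pwb z) h; rewrite le_max h.
  have wK l : cstar_spectrum a l -> cabs (powfun w l) <= K.
    by move=> /(pwb w) h; rewrite le_max h orbT.
  by apply: eq_fcalc (fcalcM as_ sr zK wK (pw z) (pw w)) => l _; rewrite powfunD.
- by apply: uniq (pw _) _; have := fcalc_cst a 1; rewrite scale1r;
    apply: eq_fcalc => l _; rewrite powfun0.
- move=> z; apply: uniq (pw _); apply: eq_fcalc (fcalc_star as_ sr (pw z)) => l _.
  by rewrite powfun_conj.
- exists (expR k) => z hz; apply: (fcalc_le as_ sr (pw z)) => l /lnk h.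
  exact: powfun_bounded.
- have hL2 := fcalcZ 2^-1 (fcalcM as_ sr lnCk lnCk hL hL).
  have [K hK] := powfun_taylor k.
  exists L, (2^-1 *: (L * L)), K => h h1.
  have hP := fcalcB (pw h)
    (fcalcD (fcalcD (fcalc_cst a 1) (fcalcZ h hL)) (fcalcZ (h ^+ 2) hL2)).
  have := fcalc_le as_ sr hP; rewrite scale1r; apply => l /lnk hl.
  by have := hK h l h1 hl; rewrite -/(lnC l) [_ / 2]mulrC expr2.
- by move=> x z; rewrite a1; exact: fcalc_comm (pw z).
Qed.

End FunctionalCalculus.

(** * Finite traces on C*-algebras *)

Section CStarTrace.
Context (R : realType) (A : cstarType R) (Tr : A -> R[i]).
Context (trTr : finite_faithful_trace Tr).
Implicit Types x y : A.

Let tr x : R := complex.Re (Tr x).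

Let Tr_lin (c : R[i]) x y : Tr (c *: x + y) = c * Tr x + Tr y.
Proof. by case: trTr. Qed.

Let Tr_pos x : 0 <= Tr (star x * x).
Proof. by case: trTr. Qed.

Let TrD x y : Tr (x + y) = Tr x + Tr y.
Proof. by rewrite -[x]scale1r Tr_lin mul1r scale1r. Qed.

Let Tr0 : Tr 0 = 0.
Proof. by apply: (@addrI _ (Tr 0)); rewrite -TrD !addr0. Qed.

Let TrZ c x : Tr (c *: x) = c * Tr x.
Proof. by rewrite -[_ *: x]addr0 Tr_lin Tr0 addr0. Qed.

Let trB x y : tr (x - y) = tr x - tr y.
Proof. by rewrite /tr -scaleN1r addrC Tr_lin mulN1r addrC raddfB. Qed.

Let trZ (r : R) x : tr (r%:C%C *: x) = r * tr x.
Proof. by rewrite /tr TrZ Re_realM. Qed.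

(** Positivity at [1 + i x], at [1] and at [i x] makes [Tr] compatible with the involution. *)
Let tr_star x : tr (star x) = tr x.
Proof.
have im y : complex.Im (Tr (star y * y)) = 0 by apply: ger0_Im; exact: Tr_pos.
have := im (1 + 'i%C *: x).
have -> : star (1 + 'i%C *: x) * (1 + 'i%C *: x) =
    star 1 * 1 + 'i%C *: x + star ('i%C *: x) + star ('i%C *: x) * ('i%C *: x).
  by rewrite starD star1 mulrDl mul1r mulrDr !mulr1 addrA.
rewrite !TrD !raddfD /= !im starZ !TrZ addr0 add0r /tr.
by case: (Tr x) (Tr (star x)) => [p q] [r s] /=; lra.
Qed.

(** [y] is the fixed point of the contraction [y |-> (x + y^2) / 2].  As the trace is
    nonnegative on squares of self-adjoint elements, this bounds the trace of [x] by
    the trace of [1]: a positive functional is continuous. *)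
Lemma small_sqrt x : star x = x -> nrm x <= 4^-1 ->
  exists2 y, star y = y & (1 - y) * (1 - y) = 1 - x.
Proof.
move=> xs x4; pose half : R[i] := 2^-1.
have half2 : half = (2^-1)%:C%C by rewrite /half fmorphV rmorph_nat.
have ch : cabs half = 2^-1 by rewrite half2 cabs_real ger0_norm.
pose F y := half *: (x + y * y).
pose u n := iter n F 0.
have uS n : u n.+1 = half *: (x + u n * u n) by [].
have us n : star (u n) = u n.
  elim: n => [|n ih]; first exact: star0.
  by rewrite uS starZ starD starM ih xs half2 conjC_realE.
have un n : nrm (u n) <= 4^-1.
  elim: n => [|n ih]; first by rewrite /= nrm0.
  rewrite uS nrmZ ch; have := nrmD x (u n * u n); have := nrmM_le ih ih; lra.
have [||y uy] := @geometric_tends_to _ _ u (2^-1) 1.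
- by lra.
- elim=> [|n ih]; rewrite mul1r.
    by rewrite subr0 expr0; have := un 1%N; lra.
  rewrite mul1r in ih; rewrite uS [X in _ - X]uS -scalerBr opprD addrACA subrr add0r.
  have -> : u n.+1 * u n.+1 - u n * u n =
    u n.+1 * (u n.+1 - u n) + (u n.+1 - u n) * u n.
    by rewrite mulrBr mulrBl addrA subrK.
  rewrite nrmZ ch exprS; have := nrm_ge0 (u n.+1 - u n).
  have := nrmD (u n.+1 * (u n.+1 - u n)) ((u n.+1 - u n) * u n).
  have := nrmM_le (un n.+1) ih; have := nrmM_le ih (un n).
  have : 0 <= (2^-1 : R) ^+ n by rewrite exprn_ge0.
  lra.
have yF : y = half *: (x + y * y).
  apply: (tends_to_unique (tends_toS uy)).
  exact: tends_toZ (tends_toD (tends_to_cst x) (tends_toM uy uy)).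
exists y.
  have := tends_to_star uy; under [X in tends_to X]eq_fun => n do rewrite us.
  by move=> h; exact: tends_to_unique h uy.
have y2 : y + y = x + y * y.
  rewrite [in LHS]yF -scalerDl.
  have -> : half + half = 1 by rewrite /half; field.
  by rewrite scale1r.
have -> : x = y + y - y * y by rewrite y2 addrK.
by rewrite mulrBr mulr1 mulrBl mul1r !opprD opprK !addrA.
Qed.

Lemma cstar_tracial_functional :
  tracial_functional (@star R A) (@nrm R A) (fun x => complex.Re (Tr x)).
Proof.
have small x : star x = x -> nrm x <= 4^-1 -> tr x <= tr 1.
  move=> xs x4; have [y ys hy] := small_sqrt xs x4.
  have := Tr_pos (1 - y); rewrite starB star1 ys hy => h.
  by rewrite -subr_ge0 -trB /tr; move: h; rewrite lecE => /andP[].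
have tr1 : 0 <= tr 1.
  have := Tr_pos 1; rewrite star1 mulr1 /tr.
  by rewrite lecE => /andP[].
have sa x : star x = x -> tr x <= 4 * tr 1 * nrm x.
  move=> xs; have [x0|x0] := eqVneq (nrm x) 0.
    by rewrite (nrm_eq0 x0) nrm0 mulr0 /tr Tr0.
  have {}x0 : 0 < nrm x by rewrite lt_def x0 nrm_ge0.
  have c0 : 0 < (4 * nrm x)^-1 by rewrite invr_gt0 mulr_gt0.
  have := small ((4 * nrm x)^-1%:C%C *: x).
  rewrite starZ conjC_realE xs nrmZ cabs_real (gtr0_norm c0) trZ.
  have -> : (4 * nrm x)^-1 * nrm x = 4^-1 by field; rewrite gt_eqF.
  move=> /(_ erefl (lexx _)); rewrite mulrC ler_pdivrMr ?mulr_gt0 //; lra.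
split.
- exact: nrmD.
- by move=> z x; rewrite nrmZ.
- exact: nrmM.
- exact: starB.
- exact: starM.
- exact: starK.
- exact: trB.
- by move=> x y; case: trTr => _ _ h _; rewrite h.
- exact: tr_star.
- by move=> x; have := Tr_pos x; rewrite lecE => /andP[].
- move=> x h; case: trTr => _ _ _; apply.
  have := ger0_Im (Tr_pos x); case: (Tr _) h => p q /= -> ->.
  by [].
exists (4 * tr 1) => [|x]; first by rewrite mulr_ge0.
have h y : tr y <= 4 * tr 1 * nrm y.
  have ss : star (y + star y) = y + star y by rewrite starD starK addrC.
  have := sa _ ss; have := nrmD y (star y); rewrite nrm_star.
  have -> : tr (y + star y) = 2 * tr y.
    by rewrite /tr TrD raddfD /= -/(tr y) -/(tr (star y)) tr_star; ring.
  have : 0 <= 4 * tr 1 by rewrite mulr_ge0.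
  nra.
rewrite ler_norml h andbT lerNl.
by have := h (- x); rewrite nrmN -[- x]sub0r trB /tr Tr0 sub0r.
Qed.

End CStarTrace.

(** * Matrices *)

Section DiagonalizedFunctions.
Local Open Scope sesquilinear_scope.
Context (R : realType) (n : nat) (U : 'M[R[i]]_n) (unitaryU : U \is unitarymx).
Context (d : 'rV[R[i]]_n).
Implicit Types (f g : R[i] -> R[i]) (i j : 'I_n) (z : R[i]).

(** [f] applied to the matrix with eigenvalues [d] and eigenvectors the rows of [U]. *)
Definition mxfun f : 'M[R[i]]_n := invmx U *m diag_mx (map_mx f d) *m U.

Let unitU : U \in unitmx := unitarymx_unit unitaryU.
Let invU : invmx U = U^t* := invmx_unitary unitaryU.

Let conj_mul (F G : 'M[R[i]]_n) :
  (invmx U *m F *m U) *m (invmx U *m G *m U) = invmx U *m (F *m G) *m U.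
Proof. by rewrite !mulmxA (mulmxK unitU). Qed.

Lemma eq_mxfun f g : (forall i, f (d 0 i) = g (d 0 i)) -> mxfun f = mxfun g.
Proof.
move=> fg; rewrite /mxfun; have -> // : map_mx f d = map_mx g d.
by apply/rowP => i; rewrite !mxE fg.
Qed.

Lemma mxfunM f g : mxfun (fun z => f z * g z) = mxfun f *m mxfun g.
Proof.
rewrite /mxfun conj_mul mulmx_diag.
have -> // : map_mx (fun z => f z * g z) d = \row_j (map_mx f d 0 j * map_mx g d 0 j).
by apply/rowP => i; rewrite !mxE.
Qed.

Lemma mxfunD f g : mxfun (fun z => f z + g z) = mxfun f + mxfun g.
Proof.
rewrite /mxfun -mulmxDl -mulmxDr -raddfD.
have -> // : map_mx (fun z => f z + g z) d = map_mx f d + map_mx g d.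
by apply/rowP => i; rewrite !mxE.
Qed.

Lemma mxfunZ z f : mxfun (fun w => z * f w) = z *: mxfun f.
Proof.
rewrite /mxfun scalemxAl scalemxAr -linearZ.
have -> // : map_mx (fun w => z * f w) d = z *: map_mx f d.
by apply/rowP => i; rewrite !mxE.
Qed.

Lemma mxfunB f g : mxfun (fun z => f z - g z) = mxfun f - mxfun g.
Proof.
rewrite -scaleN1r -mxfunZ -mxfunD; apply: eq_mxfun => i.
by rewrite mulN1r.
Qed.

Lemma mxfun_cst z : mxfun (fun=> z) = z%:M.
Proof.
rewrite /mxfun; have -> : map_mx (fun=> z) d = const_mx z by apply/rowP => i; rewrite !mxE.
by rewrite diag_const_mx mul_mx_scalar -scalemxAl mulVmx // scalemx1.
Qed.

Lemma mxfun_adj f : (mxfun f)^t* = mxfun (fun z => (f z)^*).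
Proof.
rewrite /mxfun !trmx_mul !map_mxM /= invU -map_trmx trmxK.
have conjK : map_mx Num.conj (map_mx Num.conj U) = U.
  by apply/matrixP => i j; rewrite !mxE conjCK.
rewrite conjK mulmxA tr_diag_mx map_diag_mx map_trmx.
have -> // : map_mx Num.conj (map_mx f d) = map_mx (fun z => (f z)^*) d.
by apply/rowP => i; rewrite !mxE.
Qed.

(** In a basis of eigenvectors, commuting with a diagonal matrix means vanishing
    wherever two eigenvalues differ. *)
Lemma mxfun_comm f (B : 'M[R[i]]_n) :
  B *m mxfun id = mxfun id *m B -> B *m mxfun f = mxfun f *m B.
Proof.
have -> : mxfun id = invmx U *m diag_mx d *m U.
  by rewrite /mxfun; have -> // : map_mx id d = d by apply/rowP => i; rewrite mxE.
move=> BA; pose B' := U *m B *m invmx U.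
have eB : B = invmx U *m B' *m U.
  by rewrite /B' !mulmxA (mulVmx unitU) mul1mx (mulmxKV unitU).
have B'd : B' *m diag_mx d = diag_mx d *m B'.
  have := congr1 (fun M => U *m M *m invmx U) BA.
  by rewrite /B' !mulmxA (mulmxV unitU) mul1mx (mulmxK unitU).
move: B' eB B'd => B' eB B'd.
have B'f : B' *m diag_mx (map_mx f d) = diag_mx (map_mx f d) *m B'.
  rewrite mul_mx_diag mul_diag_mx; apply/matrixP => i j; rewrite !mxE.
  have := congr1 (fun M : 'M[R[i]]_n => M i j) B'd; rewrite mul_mx_diag mul_diag_mx !mxE.
  have [-> _|ne h] := eqVneq (d 0 i) (d 0 j); first by rewrite mulrC.
  suff -> : B' i j = 0 by rewrite mulr0 mul0r.
  apply/eqP; have : (d 0 i - d 0 j) * B' i j = 0 by rewrite mulrBl -h mulrC subrr.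
  by move/eqP; rewrite mulf_eq0 subr_eq0 (negPf ne).
by rewrite eB /mxfun !conj_mul B'f.
Qed.

Lemma mxfun_eigenrow i : exists v : 'rV[R[i]]_n,
  v *m v^t* = 1%:M /\ forall f, v *m mxfun f = f (d 0 i) *: v.
Proof.
pose e : 'rV[R[i]]_n := delta_mx 0 i; exists (e *m U); split.
  rewrite trmx_mul map_mxM mulmxA -(mulmxA e) -invU mulmxV // mulmx1.
  rewrite trmx_delta map_delta_mx mul_delta_mx.
  by apply/matrixP => k l; rewrite !ord1 !mxE !eqxx.
move=> f; rewrite /mxfun !mulmxA (mulmxK unitU).
by rewrite -rowE row_diag_mx -scalemxAl mxE.
Qed.

Lemma mxfun_unit_neq0 f i : mxfun f \in unitmx -> f (d 0 i) != 0.
Proof.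
move=> unitf; apply/eqP => f0; have [v [vv vf]] := mxfun_eigenrow i.
have : v *m mxfun f *m invmx (mxfun f) = 0 by rewrite vf f0 scale0r mul0mx.
rewrite mulmxK // => v0; move: vv; rewrite v0 mul0mx => /matrixP/(_ 0 0).
by rewrite !mxE eqxx => /esym/eqP; rewrite oner_eq0.
Qed.

Lemma positive_eigenvalue i : mx_positive (mxfun id) -> mxfun id \in unitmx ->
  exists2 t : R, 0 < t & d 0 i = t%:C%C.
Proof.
move=> [_ pos] /(mxfun_unit_neq0 i) d0; have [v [vv vf]] := mxfun_eigenrow i.
have := pos v; rewrite vf -scalemxAl vv mxE mxE eqxx mulr1 => /ge0_complex[t t0 et].
exists t => //; rewrite lt_def t0 andbT; apply: contra d0 => /eqP t0'.
by rewrite et t0'.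
Qed.

End DiagonalizedFunctions.

(** The spectral theorem; [mx_pow A z] is this expression with [powfun z] for [id]. *)
Lemma mxfun_spectral (R : realType) n (A : 'M[R[i]]_n) : (A^t*)%sesqui = A ->
  mxfun (spectralmx A) (spectral_diag A) id = A.
Proof.
move=> As; have /orthomx_spectralP e : A \is normalmx by apply/normalmxP; rewrite As.
rewrite [RHS]e /mxfun; have -> // : map_mx id (spectral_diag A) = spectral_diag A.
by apply/rowP => i; rewrite mxE.
Qed.

Section MatrixCase.
Local Open Scope sesquilinear_scope.
Context (R : realType).

Definition mxnorm n (M : 'M[R[i]]_n) : R := \sum_i \sum_j cabs (M i j).

Lemma mxnorm_ge0 n (M : 'M[R[i]]_n) : 0 <= mxnorm M.
Proof. by apply: sumr_ge0 => i _; apply: sumr_ge0 => j _; exact: cabs_ge0. Qed.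

Lemma cabs_entry_le n (M : 'M[R[i]]_n) i j : cabs (M i j) <= mxnorm M.
Proof.
rewrite /mxnorm (bigD1 i) //= (bigD1 j) //= -addrA lerDl addr_ge0 //.
  by apply: sumr_ge0 => l _; exact: cabs_ge0.
by apply: sumr_ge0 => k _; apply: sumr_ge0 => l _; exact: cabs_ge0.
Qed.

Lemma mxnormM n (M P : 'M[R[i]]_n) : mxnorm (M *m P) <= mxnorm M * mxnorm P.
Proof.
rewrite /mxnorm mulr_suml; apply: ler_sum => i _.
apply: (@le_trans _ _ (\sum_j \sum_k cabs (M i k) * cabs (P k j))).
  apply: ler_sum => j _; rewrite mxE; apply: le_trans (cabs_sum _ _ _) _.
  by apply: ler_sum => k _; rewrite cabsM.
rewrite exchange_big /= mulr_suml; apply: ler_sum => k _.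
rewrite -mulr_sumr ler_wpM2l ?cabs_ge0 //.
rewrite [X in _ <= X](bigD1 k) //= lerDl.
by apply: sumr_ge0 => l _; apply: sumr_ge0 => j _; exact: cabs_ge0.
Qed.

Lemma mxfun_norm_le n (U : 'M[R[i]]_n) (d : 'rV[R[i]]_n) f (k : R) :
    (forall i, cabs (f (d 0 i)) <= k) ->
  mxnorm (mxfun U d f) <= mxnorm (invmx U) * n%:R * mxnorm U * k.
Proof.
move=> fk; apply: le_trans (mxnormM _ _) _.
have -> : mxnorm (invmx U) * n%:R * mxnorm U * k =
  mxnorm (invmx U) * (n%:R * k) * mxnorm U by ring.
apply: (ler_wpM2r (mxnorm_ge0 _)).
apply: le_trans (mxnormM _ _) _; apply: (ler_wpM2l (mxnorm_ge0 _)).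
rewrite /mxnorm; apply: (@le_trans _ _ (\sum_(i < n) k)); last first.
  by rewrite sumr_const card_ord mulr_natl.
apply: ler_sum => i _; rewrite (bigD1 i) //= big1 ?addr0 => [|j ji].
  by rewrite !mxE eqxx mulr1n.
by rewrite !mxE eq_sym (negPf ji) mulr0n cabs0.
Qed.

Lemma mx_tracial_functional n :
  @tracial_functional R 'M[R[i]]_n.+1 (fun M => M^t*) (@mxnorm n.+1)
    (fun M => complex.Re (\tr M)).
Proof.
have trE (M : 'M[R[i]]_n.+1) : complex.Re (\tr (M^t* *m M)) = \sum_i \sum_j cabs (M j i) ^+ 2.
  rewrite /mxtrace raddf_sum; apply: eq_bigr => i _; rewrite mxE raddf_sum.
  apply: eq_bigr => j _; rewrite !mxE mulrC -normCK cabsE -rmorphXn.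
  by [].
split.
- move=> M P; rewrite /mxnorm -big_split; apply: ler_sum => i _ /=.
  by rewrite -big_split; apply: ler_sum => j _ /=; rewrite mxE cabsD.
- move=> z M; rewrite /mxnorm mulr_sumr; apply: ler_sum => i _.
  by rewrite mulr_sumr; apply: ler_sum => j _; rewrite mxE cabsM.
- exact: mxnormM.
- by move=> M P; rewrite raddfB map_mxB.
- by move=> M P; rewrite trmx_mul map_mxM.
- by move=> M; apply/matrixP => i j; rewrite !mxE conjCK.
- by move=> M P; rewrite raddfB raddfB.
- by move=> M P; rewrite mxtrace_mulC.
- move=> M; rewrite /mxtrace !raddf_sum; apply: eq_bigr => i _.
  by rewrite !mxE; case: (M i i).
- by move=> M; rewrite trE; apply: sumr_ge0 => i _; apply: sumr_ge0 => j _; exact: sqr_ge0.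
- move=> M; rewrite trE => h; apply/matrixP => i j; rewrite mxE; apply: cabs0_eq0.
  apply/eqP; rewrite -sqrf_eq0; apply/eqP.
  have h1 := psumr_eq0P (fun k _ => sumr_ge0 _ (fun l _ => sqr_ge0 (cabs (M l k)))) h.
  exact: (psumr_eq0P (fun l _ => sqr_ge0 (cabs (M l j))) (h1 j isT)).
exists 1 => // M; rewrite mul1r; apply: le_trans (cabs_Re _) _.
apply: le_trans (cabs_sum _ _ _) _; apply: ler_sum => i _.
rewrite (bigD1 i) //= lerDl; apply: sumr_ge0 => j _; exact: cabs_ge0.
Qed.

Lemma mx_complex_powers n (A : 'M[R[i]]_n.+1) : mx_positive A -> A \in unitmx ->
  complex_powers (fun M : 'M[R[i]]_n.+1 => M^t*) (@mxnorm n.+1) (mx_pow A) /\ mx_pow A 1 = A.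
Proof.
move=> pA uA; have idA := mxfun_spectral pA.1.
have powE z : mx_pow A z = mxfun (spectralmx A) (spectral_diag A) (powfun z) by [].
have unitaryU := spectral_unitarymx A.
move: (mx_pow A) powE unitaryU idA; move: (spectralmx A) (spectral_diag A).
move=> U d pw powE unitaryU idA.
have dpos i : exists2 t : R, 0 < t & d 0 i = t%:C%C.
  by apply: (positive_eigenvalue unitaryU); rewrite idA.
pose lnC (t : R[i]) : R[i] := (ln (complex.Re t))%:C%C.
pose k := \sum_i `|ln (complex.Re (d 0 i))|.
have lnk i : `|ln (complex.Re (d 0 i))| <= k.
  by rewrite /k (bigD1 i) //= lerDl; apply: sumr_ge0.
have a1 : pw 1 = A.
  rewrite powE -[RHS]idA; apply: eq_mxfun => i.
  by have [t t0 ->] := dpos i; rewrite powfun1.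
split=> //; split.
- move=> z w; rewrite !powE -[_ * _]/(_ *m _) -(mxfunM unitaryU).
  by apply: eq_mxfun => i; rewrite powfunD.
- rewrite powE -[1]/(1%:M) -(mxfun_cst unitaryU d 1).
  by apply: eq_mxfun => i; rewrite powfun0.
- move=> z; rewrite !powE (mxfun_adj unitaryU).
  by apply: eq_mxfun => i; rewrite powfun_conj.
- eexists=> z hz; rewrite powE; apply: mxfun_norm_le => i.
  exact: powfun_bounded (lnk i) hz.
- have [K hK] := powfun_taylor k.
  exists (mxfun U d lnC), (mxfun U d (fun t => lnC t ^+ 2 / 2)).
  exists (mxnorm (invmx U) * n.+1%:R * mxnorm U * K) => h h1.
  have -> : pw h - (1 + h *: mxfun U d lnC + h ^+ 2 *: mxfun U d (fun t => lnC t ^+ 2 / 2)) =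
      mxfun U d (fun t => powfun h t - (1 + h * lnC t + h ^+ 2 * (lnC t ^+ 2 / 2))).
    by rewrite mxfunB !mxfunD !mxfunZ (mxfun_cst unitaryU) -powE.
  by rewrite -mulrA; apply: mxfun_norm_le => i; exact: hK.
by move=> B z; rewrite a1 -idA powE; exact: mxfun_comm.
Qed.

(** Size [0] is apart because the matrices of that size do not form a nontrivial
    ring. *)
Theorem matrix_case n (A B : 'M[R[i]]_n) :
    mx_positive A -> A \in unitmx -> mx_positive B -> B \in unitmx ->
    (exists z, 4^-1 <= complex.Re z <= 3 / 4 /\
      complex.Re (\tr (mx_pow A z *m mx_pow B z *m mx_pow A (1 - z) *m mx_pow B (1 - z)))
        = complex.Re (\tr (A *m B))) ->
  A *m B = B *m A /\ forall z,
    complex.Re (\tr (mx_pow A z *m mx_pow B z *m mx_pow A (1 - z) *m mx_pow B (1 - z)))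
      = complex.Re (\tr (A *m B)).
Proof.
case: n A B => [|n] A B pA uA pB uB h.
  split=> [|z]; first by rewrite [LHS]flatmx0 [RHS]flatmx0.
  by rewrite /mxtrace !big_ord0.
have [PA A1] := mx_complex_powers pA uA; have [PB B1] := mx_complex_powers pB uB.
have := heinz_equality (mx_tracial_functional n) PA PB.
by rewrite A1 B1; apply.
Qed.

End MatrixCase.

(** * Operators on a Hilbert space *)

Section HilbertBasics.
Context (R : realType) (H : hilbertType R).
Implicit Types (x y w : H) (a : R[i]) (T S : H -> H).

Lemma ipDl x y w : ip (x + y) w = ip x w + ip y w.
Proof. by have := ip_linear 1 x y w; rewrite scale1r mul1r. Qed.

Lemma ip0l w : ip 0 w = 0.
Proof. by apply: (@addrI _ (ip 0 w)); rewrite -ipDl !addr0. Qed.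

Lemma ipZl a x w : ip (a *: x) w = a * ip x w.
Proof. by have := ip_linear a x 0 w; rewrite addr0 ip0l addr0. Qed.

Lemma ipDr x y w : ip w (x + y) = ip w x + ip w y.
Proof. by rewrite ip_conj ipDl rmorphD /= -!ip_conj. Qed.

Lemma ipZr a x w : ip w (a *: x) = a^* * ip w x.
Proof. by rewrite ip_conj ipZl rmorphM /= -ip_conj. Qed.

Lemma ip_suml (I : Type) (r : seq I) (F : I -> H) w :
  ip (\sum_(i <- r) F i) w = \sum_(i <- r) ip (F i) w.
Proof. by elim/big_rec2: _ => [|i u v _ <-]; rewrite ?ip0l ?ipDl. Qed.

Lemma ip_sumr (I : Type) (r : seq I) (F : I -> H) w :
  ip w (\sum_(i <- r) F i) = \sum_(i <- r) ip w (F i).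
Proof. by rewrite ip_conj ip_suml rmorph_sum; apply: eq_bigr => i _ /=; rewrite -ip_conj. Qed.

Lemma ipBl x y w : ip (x - y) w = ip x w - ip y w.
Proof. by rewrite -scaleN1r ipDl ipZl mulN1r. Qed.

Lemma ipBr x y w : ip w (x - y) = ip w x - ip w y.
Proof. by rewrite -scaleN1r ipDr ipZr rmorphN rmorph1 mulN1r. Qed.

(** Bessel's inequality for one vector. *)
Lemma bessel1 x b : ip b b = 1 -> `|ip x b| <= `|x|.
Proof.
move=> bb; rewrite -(@ler_pXn2r _ 2) ?nnegrE // -ip_norm normCK -subr_ge0.
have -> : ip x x - ip x b * (ip x b)^* = ip (x - ip x b *: b) (x - ip x b *: b).
  rewrite ipBl !ipBr !ipZl !ipZr bb [ip b x]ip_conj; ring.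
by rewrite ip_norm exprn_ge0.
Qed.

Section Linear.
Context (T : H -> H) (linT : linear T).

Lemma opD x y : T (x + y) = T x + T y.
Proof. by have := linT 1 x y; rewrite !scale1r. Qed.

Lemma op0 : T 0 = 0.
Proof. by apply: (@addrI _ (T 0)); rewrite -opD !addr0. Qed.

Lemma opZ a x : T (a *: x) = a *: T x.
Proof. by have := linT a x 0; rewrite op0 !addr0. Qed.

Lemma opB x y : T (x - y) = T x - T y.
Proof. by rewrite -scaleN1r opD opZ scaleN1r. Qed.

Lemma op_sum (I : Type) (r : seq I) (F : I -> H) :
  T (\sum_(i <- r) F i) = \sum_(i <- r) T (F i).
Proof. by elim/big_rec2: _ => [|i u v _ <-]; rewrite ?op0 ?opD. Qed.

Lemma bounded_linear_op (C : R[i]) : 0 <= C -> (forall x, `|T x| <= C * `|x|) ->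
  bounded_operator T.
Proof.
move=> C0 TC; split=> // x; apply/cvgrPdist_lt => e e0.
have C1 : 0 < C + 1 by rewrite ltr_wpDl.
have d0 : 0 < e / (C + 1) by rewrite divr_gt0.
near=> y; rewrite -opB; apply: le_lt_trans (TC _) _.
have xy : `|x - y| < e / (C + 1).
  by near: y; apply: cvgr_dist_lt => //; exact: cvg_id.
rewrite ltr_pdivlMr // in xy; apply: le_lt_trans xy.
by rewrite mulrC ler_wpM2l // lerDl.
Unshelve. all: by end_near. Qed.

Lemma bounded_op_le : continuous T -> exists2 C : R[i], 0 < C &
  forall x, `|T x| <= C * `|x|.
Proof.
move=> /(_ 0)/cvgrPdist_lt /(_ 1 ltr01); rewrite op0 => /nbhs_ballP[d /= d0 hd].
exists (2 / d); first by rewrite divr_gt0.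
move=> x; have [->|x0] := eqVneq x 0; first by rewrite op0 !normr0 mulr0.
have xn : 0 < `|x| by rewrite normr_gt0.
pose c : R[i] := d / (2 * `|x|).
have c0 : 0 < c by rewrite divr_gt0 // mulr_gt0.
have := hd (c *: x); rewrite -ball_normE /= sub0r normrN normrZ gtr0_norm //.
rewrite sub0r normrN opZ normrZ gtr0_norm // => h.
have : c * `|T x| < 1.
  apply: h; have -> : c * `|x| = d / 2 by rewrite /c; field; rewrite gt_eqF.
  by rewrite ltr_pdivrMr // ltr_pMr // ltr1n.
rewrite mulrC -ltr_pdivlMr // mul1r => /ltW/le_trans; apply.
by rewrite le_eqVlt; apply/orP; left; apply/eqP; rewrite /c; field; rewrite !gt_eqF.
Qed.

(** Polarization at [x + y] and [x + i y] of a quadratic form with real values. *)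
Lemma op_positive_adj : op_positive T -> forall x y, ip (T x) y = (ip (T y) x)^*.
Proof.
move=> pT x y.
have im w : complex.Im (ip (T w) w) = 0 by apply: ger0_Im; exact: pT.
have := im (x + y); rewrite opD ipDl !ipDr !raddfD /= !im.
have := im (x + 'i%C *: y); rewrite opD ipDl !ipDr !raddfD /= !im opZ !ipZl !ipZr.
case: (ip (T x) y) (ip (T y) x) => [p q] [r s] /= h1 h2.
by apply/eqP; rewrite eq_complex /=; apply/andP; split; apply/eqP; lra.
Qed.

End Linear.
End HilbertBasics.

(** Orthonormal coordinates turn the linear operators of a finite-dimensional
    space into matrices acting on columns. *)
Section Coordinates.
Context (R : realType) (H : hilbertType R) (m : nat) (b : 'I_m -> H).
Context (b_orth : forall i j, ip (b i) (b j) = (i == j)%:R).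
Context (b_full : forall x, (forall i, ip x (b i) = 0) -> x = 0).
Implicit Types (x y : H) (T S : H -> H) (M P : 'M[R[i]]_m).

Definition op_mx T : 'M[R[i]]_m := \matrix_(k, j) ip (T (b j)) (b k).

Definition mx_op M x : H := \sum_k (\sum_j M k j * ip x (b j)) *: b k.

Lemma ip_expand (c : 'I_m -> R[i]) k : ip (\sum_j c j *: b j) (b k) = c k.
Proof.
rewrite ip_suml (bigD1 k) //= ipZl b_orth eqxx mulr1 big1 ?addr0 // => j jk.
by rewrite ipZl b_orth (negPf jk) mulr0.
Qed.

Lemma basis_norm k : `|b k| = 1.
Proof.
have := ip_norm (b k); rewrite b_orth eqxx => /esym/eqP.
by rewrite sqrp_eq1 // => /eqP.
Qed.

Lemma basis_expand x : x = \sum_j ip x (b j) *: b j.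
Proof.
apply/eqP; rewrite -subr_eq0; apply/eqP/b_full => k.
by rewrite ipBl ip_expand subrr.
Qed.

Lemma op_mxK T : linear T -> mx_op (op_mx T) = T.
Proof.
move=> linT; apply/funext => x; rewrite [RHS]basis_expand /mx_op.
apply: eq_bigr => k _; congr (_ *: _).
rewrite {2}[x]basis_expand (op_sum linT) ip_suml; apply: eq_bigr => j _.
by rewrite (opZ linT) ipZl mxE mulrC.
Qed.

Lemma mx_opK M : op_mx (mx_op M) = M.
Proof.
apply/matrixP => k j; rewrite mxE /mx_op ip_expand (bigD1 j) //= b_orth eqxx mulr1.
by rewrite big1 ?addr0 // => l lj; rewrite b_orth eq_sym (negPf lj) mulr0.
Qed.

Lemma op_mx_comp S T : linear S -> op_mx (S \o T) = op_mx S *m op_mx T.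
Proof.
move=> linS; apply/matrixP => k j; rewrite !mxE /= [T (b j)]basis_expand.
rewrite (op_sum linS) ip_suml; apply: eq_bigr => l _.
by rewrite (opZ linS) ipZl !mxE mulrC.
Qed.

Lemma op_mx_id : op_mx id = 1%:M.
Proof. by apply/matrixP => k j; rewrite !mxE b_orth eq_sym. Qed.

Lemma mx_op_linear M : linear (mx_op M).
Proof.
move=> a x y; rewrite /mx_op scaler_sumr -big_split; apply: eq_bigr => k _ /=.
rewrite scalerA -scalerDl mulr_sumr -big_split; congr (_ *: _).
by apply: eq_bigr => j _ /=; rewrite ip_linear; ring.
Qed.

Lemma mx_op_bounded M : bounded_operator (mx_op M).
Proof.
apply: (bounded_linear_op (mx_op_linear M) (C := \sum_k \sum_j `|M k j|)) => [|x].
  by apply: sumr_ge0 => k _; apply: sumr_ge0.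
rewrite mulr_suml; apply: le_trans (ler_norm_sum _ _ _) _; apply: ler_sum => k _.
rewrite normrZ basis_norm mulr1 mulr_suml; apply: le_trans (ler_norm_sum _ _ _) _.
apply: ler_sum => j _; rewrite normrM ler_wpM2l // bessel1 // b_orth eqxx //.
Qed.

Lemma cabs_entry_triangle (X Y Z : 'M[R[i]]_m) k j (r s : R) :
  cabs ((X - Y) k j) <= r -> cabs ((Y - Z) k j) <= s -> cabs ((X - Z) k j) <= r + s.
Proof.
move=> hr hs; have -> : (X - Z) k j = (X - Y) k j + (Y - Z) k j.
  by rewrite !mxE addrA subrK.
exact: le_trans (cabsD _ _) (lerD hr hs).
Qed.

Section PositiveOperator.
Context (T : H -> H) (linT : linear T) (posT : op_positive T) (invT : op_invertible T).

Lemma op_mx_positive : mx_positive (op_mx T).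
Proof.
split=> [|v].
  by apply/matrixP => k j; rewrite !mxE [in RHS](op_positive_adj linT).
have := posT (\sum_j (v 0 j)^* *: b j).
rewrite (op_sum linT) ip_suml; congr (0 <= _).
rewrite mxE; apply: eq_bigr => j _; rewrite !mxE (opZ linT) ipZl mulrC; congr (_ * _).
rewrite ip_sumr; apply: eq_bigr => k _.
by rewrite ipZr conjCK !mxE.
Qed.

Lemma op_mx_unit : op_mx T \in unitmx.
Proof.
have [S [_ TS _]] := invT.
have := op_mx_comp S linT; rewrite TS op_mx_id => /esym/mulmx1_unit[].
by [].
Qed.

Let A := op_mx T.
Let U := spectralmx A.
Let d := spectral_diag A.
Let F f : 'M[R[i]]_m := mxfun U d f.

Let unitaryU : U \is unitarymx := spectral_unitarymx A.

Let F_id : F id = A.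
Proof. exact: (mxfun_spectral op_mx_positive.1). Qed.

Lemma op_horner_linear (p : {poly R[i]}) : linear (op_horner p T).
Proof.
have iter_lin n : linear (iter n T).
  by elim: n => [|n ih] a x y //=; rewrite ih linT.
move=> a x y; rewrite /op_horner scaler_sumr -big_split; apply: eq_bigr => i _ /=.
by rewrite iter_lin scalerDr !scalerA mulrC.
Qed.

Lemma op_mx_horner (p : {poly R[i]}) : op_mx (op_horner p T) = F (fun t => p.[t]).
Proof.
have iterF n : op_mx (iter n T) = F (fun t => t ^+ n).
  elim: n => [|n ih]; first by rewrite op_mx_id /F (mxfun_cst unitaryU).
  have -> : iter n.+1 T = T \o iter n T by [].
  rewrite (op_mx_comp _ linT) ih -/A -F_id /F -(mxfunM unitaryU).
  by apply: eq_mxfun => i; rewrite exprS.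
have -> : F (fun t => p.[t]) = \sum_(i < size p) p`_i *: F (fun t => t ^+ i).
  transitivity (F (fun t => \sum_(i < size p) p`_i * t ^+ i)).
    by apply: eq_mxfun => i; rewrite horner_coef.
  elim: (size p) => [|n ih].
    rewrite big_ord0 /F -(scale0r (F (fun=> 0))) /F -mxfunZ.
    by apply: eq_mxfun => i; rewrite big_ord0 mul0r.
  rewrite big_ord_recr /= -ih /F -mxfunZ -mxfunD; apply: eq_mxfun => i.
  by rewrite big_ord_recr.
apply/matrixP => k j; rewrite mxE summxE ip_suml; apply: eq_bigr => i _.
by rewrite -iterF !mxE ipZl.
Qed.

Lemma op_spectrum_eigen l : op_spectrum T l <-> exists i, l = d 0 i.
Proof.
have Fl : op_mx (fun x => T x - l *: x) = F (fun t => t - l).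
  rewrite /F mxfunB (mxfun_cst unitaryU) -/(F id) F_id.
  by apply/matrixP => k j; rewrite !mxE ipBl ipZl b_orth eq_sym mulr_natr.
have lin : linear (fun x => T x - l *: x).
  by move=> a x y; rewrite linT scalerBr scalerDr !scalerA opprD addrACA [l * a]mulrC.
split=> [hl|[i li] [S [_ TS _]]].
  apply: contrapT => hd; apply: hl.
  have inv : F (fun t => t - l) *m F (fun t => (t - l)^-1) = 1%:M.
    rewrite /F -(mxfunM unitaryU) -(mxfun_cst unitaryU d); apply: eq_mxfun => i.
    by rewrite mulfV // subr_eq0; apply/eqP => e; apply: hd; exists i.
  have inv' : F (fun t => (t - l)^-1) *m F (fun t => t - l) = 1%:M by exact: mulmx1C.
  exists (mx_op (F (fun t => (t - l)^-1))); split; first exact: mx_op_bounded.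
    rewrite -[LHS]op_mxK; last first.
      by move=> a x y; rewrite /= -lin mx_op_linear.
    by rewrite op_mx_comp // Fl mx_opK inv -op_mx_id op_mxK.
  rewrite -[LHS]op_mxK; last first.
    by move=> a x y; rewrite /= -mx_op_linear -lin.
  by rewrite op_mx_comp ?Fl ?mx_opK ?inv' -?op_mx_id ?op_mxK //; exact: mx_op_linear.
have := op_mx_comp S lin; rewrite TS op_mx_id Fl => /esym/mulmx1_unit[] unitF _.
by have := mxfun_unit_neq0 unitaryU i unitF; rewrite li subrr eqxx.
Qed.

Lemma poly_interpolation (s : seq R[i]) (f : R[i] -> R[i]) :
  exists p : {poly R[i]}, forall t, t \in s -> p.[t] = f t.
Proof.
elim: s => [|t s [p hp]]; first by exists 0.
have [ts|ts] := boolP (t \in s).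
  by exists p => u; rewrite in_cons => /orP[/eqP->|]; exact: hp.
pose q := \prod_(u <- s) ('X - u%:P).
have qt : q.[t] != 0 by rewrite -[_ == 0]/(root q t) root_prod_XsubC.
exists (p + ((f t - p.[t]) / q.[t]) *: q) => u.
rewrite hornerD hornerZ in_cons => /orP[/eqP->|us]; first by rewrite divfK // addrC subrK.
have /rootP -> : root q u by rewrite root_prod_XsubC.
by rewrite mulr0 addr0 hp.
Qed.

(** Some polynomial agrees with [f] on the finite spectrum, which gives existence;
    uniqueness holds because [mxfun] is continuous in the values of [f]. *)
Lemma op_fcalcP (f : R[i] -> R[i]) S : op_fcalc f T S <-> S = mx_op (F f).
Proof.
split=> [[[linS _] hS]|->].
  rewrite -(op_mxK linS); congr mx_op; apply/eqP; rewrite -subr_eq0; apply/eqP/matrixP => k j.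
  rewrite [RHS]mxE; apply: cabs0_eq0; apply/eqP; rewrite eq_le cabs_ge0 andbT.
  have [c c0 hc] : exists2 c : R, 0 <= c & forall g (r : R),
      (forall i, cabs (g (d 0 i)) <= r) -> mxnorm (F g) <= c * r.
    exists (mxnorm (invmx U) * m%:R * mxnorm U); last by move=> g r; exact: mxfun_norm_le.
    by rewrite mulr_ge0 ?mxnorm_ge0 // mulr_ge0 ?mxnorm_ge0.
  pose K := 1 + c; have K0 : 0 < K by rewrite ltr_pwDl.
  apply/ler_addgt0Pl => e e0; rewrite addr0.
  have [|p [p1 p2]] := hS (e / K)%:C%C; first by rewrite ltcR divr_gt0.
  have h1 : cabs ((op_mx S - F (fun t => p.[t])) k j) <= e / K.
    rewrite -op_mx_horner !mxE -cabsN opprB -ipBl -lecR -cabsE.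
    apply: le_trans (bessel1 _ _) _; first by rewrite b_orth eqxx.
    by have := p2 (b j); rewrite basis_norm mulr1.
  have h2 : cabs ((F (fun t => p.[t]) - F f) k j) <= c * (e / K).
    apply: le_trans (cabs_entry_le _ _ _) _.
    rewrite /F -mxfunB; apply: hc => i.
    by rewrite -lecR -cabsE; apply/ltW/p1/op_spectrum_eigen; exists i.
  apply: le_trans (cabs_entry_triangle h1 h2) _.
  by rewrite -[X in X + _]mul1r -mulrDl mulrC divfK // gt_eqF.
split; first exact: mx_op_bounded.
move=> e e0; have [p hp] := poly_interpolation [seq d 0 i | i <- enum 'I_m] f.
have pd i : p.[d 0 i] = f (d 0 i) by apply: hp; apply/mapP; exists i; rewrite ?mem_enum.
exists p; split=> [l /op_spectrum_eigen[i ->]|x]; first by rewrite pd subrr normr0.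
rewrite -(op_mxK (op_horner_linear p)) op_mx_horner.
have -> : F (fun t => p.[t]) = F f by apply: eq_mxfun.
by rewrite subrr normr0 mulr_ge0 // ltW.
Qed.

Lemma op_powE z : op_pow T z = mx_op (mx_pow (op_mx T) z).
Proof.
have h : op_fcalc (powfun z) T (op_pow T z).
  by rewrite /op_pow; apply: xgetPex; exists (mx_op (F (powfun z))); apply/op_fcalcP.
by move/op_fcalcP: h.
Qed.

End PositiveOperator.

(** [op_mx] is an isomorphism that carries composition, trace, positivity and
    [op_pow] to their counterparts for matrices. *)
Lemma finite_dim_case (A B : H -> H) : linear A -> linear B ->
    op_positive A -> op_invertible A -> op_positive B -> op_invertible B ->
  let tr T := complex.Re (\sum_j ip (T (b j)) (b j)) in
  let F z := tr (op_pow A z \o op_pow B z \o op_pow A (1 - z) \o op_pow B (1 - z)) in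
    (exists z, 4^-1 <= complex.Re z <= 3 / 4 /\ F z = tr (A \o B)) ->
  A \o B = B \o A /\ forall z, F z = tr (A \o B).
Proof.
move=> lA lB pA iA pB iB tr F hz.
have trE T : tr T = complex.Re (\tr (op_mx T)).
  by rewrite /tr /mxtrace; congr complex.Re; apply: eq_bigr => j _; rewrite mxE.
have powE T : linear T -> op_positive T -> op_invertible T -> forall z,
    linear (op_pow T z) /\ op_mx (op_pow T z) = mx_pow (op_mx T) z.
  move=> lT pT iT z; rewrite (op_powE lT pT) mx_opK.
  by split=> //; exact: mx_op_linear.
have comp S T : linear S -> linear T -> linear (S \o T).
  by move=> lS lT a x y; rewrite /= lT lS.
have FE z : F z = complex.Re (\tr (mx_pow (op_mx A) z *m mx_pow (op_mx B) z *m
    mx_pow (op_mx A) (1 - z) *m mx_pow (op_mx B) (1 - z))).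
  have [lAz <-] := powE _ lA pA iA z; have [lBz <-] := powE _ lB pB iB z.
  have [lAz' <-] := powE _ lA pA iA (1 - z); have [_ <-] := powE _ lB pB iB (1 - z).
  have l2 := comp _ _ lAz lBz; have l3 := comp _ _ l2 lAz'.
  by rewrite /F trE (op_mx_comp _ l3) (op_mx_comp _ l2) (op_mx_comp _ lAz).
rewrite trE (op_mx_comp _ lA) in hz *.
have [|AB hF] := matrix_case (op_mx_positive lA pA) (op_mx_unit lA iA)
  (op_mx_positive lB pB) (op_mx_unit lB iB).
  by case: hz => z [h1 h2]; exists z; rewrite -FE.
split=> [|z]; last by rewrite FE hF.
rewrite -(op_mxK (comp _ _ lA lB)) -(op_mxK (comp _ _ lB lA)).
by rewrite (op_mx_comp _ lA) (op_mx_comp _ lB) AB.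
Qed.

End Coordinates.

(** * Hilbert-Schmidt operators with a bounded inverse *)

Section HilbertSchmidtCase.
Context (R : realType) (H : hilbertType R) (I : set nat) (e : nat -> H).
Context (eI : orthonormal_basis I e).

(** An invertible operator maps the basis to vectors whose norms are bounded
    below, so that their squares are summable only if the basis is finite. *)
Lemma hilbert_schmidt_finite (A : H -> H) : hilbert_schmidt I e A -> op_invertible A ->
  exists N, forall i, I i -> (i < N)%N.
Proof.
move=> [[linA _] [M hM]] [S [[linS cS] _ SA]].
have [C C0 SC] := bounded_op_le linS cS.
have Ae i : I i -> 1 <= C ^+ 2 * `|A (e i)| ^+ 2.
  move=> Ii; rewrite -exprMn.
  have e1 : `|e i| ^+ 2 = 1 by rewrite -ip_norm eI.1 // eqxx.
  rewrite -e1 ler_pXn2r // ?nnegrE ?mulr_ge0 ?(ltW C0) //.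
  by rewrite -[e i in X in X <= _](congr1 (fun F => F (e i)) SA) /=; exact: SC.
pose count n := (\sum_(i < n | `[< I i >]) 1)%N.
have countS n : count n.+1 = (count n + `[< I n >])%N.
  by rewrite /count big_mkcond big_ord_recr -big_mkcond /=; case: ifP.
have count_mono : {homo count : m n / (m <= n)%N}.
  by apply: homo_leq => // [? ? ?|n]; [exact: leq_trans|rewrite countS leq_addr].
have countM n : (count n)%:R <= C ^+ 2 * M.
  apply: le_trans (_ : C ^+ 2 * \sum_(i < n | `[< I i >]) `|A (e i)| ^+ 2 <= _).
    rewrite /count natr_sum mulr_sumr; apply: ler_sum => i /asboolP; exact: Ae.
  by apply: ler_wpM2l (hM n); rewrite exprn_ge0 // ltW.
apply: contrapT => hN.
have next n : exists2 i, (n <= i)%N & I i.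
  apply: contrapT => h; apply: hN; exists n => i Ii; rewrite ltnNge; apply/negP => ni.
  by apply: h; exists i.
have big k : exists n, (k <= count n)%N.
  elim: k => [|k [n kn]]; first by exists 0%N.
  have [i ni Ii] := next n; exists i.+1.
  by rewrite countS asboolT // addn1 ltnS (leq_trans kn) // count_mono.
have [r r0 er] := ge0_complex (le_trans (ler0n _ (count 0)) (countM 0%N)).
have [n hn] := big (Num.bound r).
have := countM n; rewrite er -(rmorph_nat (real_complex R)) lecR leNgt => /negP; apply.
by apply: lt_le_trans (archi_boundP r0) _; rewrite ler_nat.
Qed.

(** For a finite basis the partial sums that define the trace are stationary. *)
Lemma op_trace_finite N (T : H -> H) : (forall i, I i -> (i < N)%N) ->
  op_trace I e T = \sum_(i <- [seq i <- iota 0 N | `[< I i >]]) ip (T (e i)) (e i).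
Proof.
move=> IN; apply: (@norm_lim_near_cst _ R[i]^o).
exists N => // n /= Nn; rewrite big_filter.
rewrite -(big_mkord (fun i => `[< I i >]) (fun i => ip (T (e i)) (e i))).
rewrite (big_cat_nat _ Nn) //= [X in _ + X]big_nat_cond [X in _ + X]big1 ?addr0.
  by rewrite /index_iota subn0.
move=> i /andP[/andP[Ni _] /asboolP /IN]; by rewrite ltnNge Ni.
Qed.

Lemma hilbert_schmidt_case (A B : H -> H) :
    hilbert_schmidt I e A -> hilbert_schmidt I e B ->
    op_positive A -> op_invertible A -> op_positive B -> op_invertible B ->
  let tr T := complex.Re (op_trace I e T) in
  let F z := tr (op_pow A z \o op_pow B z \o op_pow A (1 - z) \o op_pow B (1 - z)) in
    (exists z, 4^-1 <= complex.Re z <= 3 / 4 /\ F z = tr (A \o B)) ->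
  A \o B = B \o A /\ forall z, F z = tr (A \o B).
Proof.
move=> hA hB pA iA pB iB tr F.
have [N IN] := hilbert_schmidt_finite hA iA.
pose s := [seq i <- iota 0 N | `[< I i >]].
pose b (j : 'I_(size s)) := e (nth 0%N s j).
have sI (j : 'I_(size s)) : I (nth 0%N s j).
  by have := mem_nth 0%N (ltn_ord j); rewrite mem_filter => /andP[/asboolP].
have us : uniq s by rewrite filter_uniq // iota_uniq.
have b_orth i j : ip (b i) (b j) = (i == j)%:R.
  by rewrite /b eI.1 ?nth_uniq.
have b_full x : (forall i, ip x (b i) = 0) -> x = 0.
  move=> hx; apply: eI.2 => i Ii.
  have si : i \in s by rewrite mem_filter mem_iota add0n IN // asboolT.
  have js : (index i s < size s)%N by rewrite index_mem.
  by have := hx (Ordinal js); rewrite /b nth_index.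
have trE T : tr T = complex.Re (\sum_j ip (T (b j)) (b j)).
  rewrite /tr (op_trace_finite _ IN) -/s (big_nth 0%N) big_mkord.
  by [].
move=> [z0 [hz0 ez0]].
have [|AB hF] := finite_dim_case b_orth b_full hA.1.1 hB.1.1 pA iA pB iB.
  by exists z0; split=> //; exact: etrans (esym (trE _)) (etrans ez0 (trE _)).
split=> // z; exact: etrans (trE _) (etrans (hF z) (esym (trE _))).
Qed.

End HilbertSchmidtCase.

(** * Equality in the trace inequality *)

Theorem proposition2p5 (R : realType) (X : tracedAlgebra R)
    (hX : operator_algebra X) (A B : X)
    (memA : alg_mem A) (memB : alg_mem B)
    (posA : positive A /\ invertible A) (posB : positive B /\ invertible B)
    (hz : exists z0 : R[i],
      4^-1 <= complex.Re z0 <= 3 / 4 /\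
      tau (A ^z z0 ⋅ B ^z z0 ⋅ A ^z (1 - z0) ⋅ B ^z (1 - z0)) = tau (A ⋅ B)) :
  A ⋅ B = B ⋅ A /\
  forall z : R[i],
    tau (A ^z z ⋅ B ^z z ⋅ A ^z (1 - z) ⋅ B ^z (1 - z)) = tau (A ⋅ B).
Proof.
case: hX A B memA memB posA posB hz => [n|H I e _ eI|C Tr trTr] A B memA memB.
- move=> [pA iA] [pB iB]; exact: matrix_case.
- move=> [pA iA] [pB iB]; exact: (hilbert_schmidt_case eI memA memB).
move=> [pA iA] [pB iB].
have [PA A1] := cstar_complex_powers pA iA.
have [PB B1] := cstar_complex_powers pB iB.
have := heinz_equality (cstar_tracial_functional trTr) PA PB.
by rewrite A1 B1; apply.
Qed.
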